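(* Let $p\in(1,\infty)$. Then the family of Kalton interlaced graphs $([\mathbb{N}]^k,d_{\mathbb{K}}^k)_{k\in\mathbb{N}}$ does not equi-coarsely embed into the James space $\mathcal{J}_p$, nor does it equi-coarsely embed into its dual $\mathcal{J}_p^*$.
   Context: James space: for $p\in(1,\infty)$, $\mathcal{J}_p$ is the real Banach space of all sequences $x=(x(n))_{n\in\mathbb{N}}$ of real numbers with finite $p$-variation and with $\lim_{n\to\infty}x(n)=0$, endowed with the norm $\|x\|_{\mathcal{J}_p}=\sup\{(\sum_{i=1}^{k-1}|x(p_{i+1})-x(p_i)|^p)^{1/p}:1\le p_1<p_2<\dots<p_k\}$ (the supremum being over all finite increasing sequences of positive integers; finite $p$-variation means this supremum is finite). Kalton interlaced graphs: for $k\in\mathbb{N}$, $[\mathbb{N}]^k$ is the set of subsets of $\mathbb{N}$ of cardinality $k$, whose elements are listed in increasing order, $\overline{n}=(n_1,\dots,n_k)$ with $n_1<\dots<n_k$. Two distinct elements $\overline{m}\ne\overline{n}$ of $[\mathbb{N}]^k$ are adjacent if $n_1\le m_1\le n_2\le\dots\le n_k\le m_k$ or $m_1\le n_1\le m_2\le\dots\le m_k\le n_k$. The metric $d_{\mathbb{K}}^k$ is the shortest path distance of this graph. Equi-coarse embedding: for a map $f:M\to N$ between metric spaces and $t\in[0,\infty)$, put $\rho_f(t)=\inf\{d_N(f(x),f(y)):d_M(x,y)\ge t\}$ and $\omega_f(t)=\sup\{d_N(f(x),f(y)):d_M(x,y)\le t\}$ (with $\inf\emptyset=\infty$, $\sup\emptyset=0$).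 A family $(M_i)_{i\in I}$ of metric spaces equi-coarsely embeds into a metric space $N$ if there exist maps $\rho,\omega:[0,\infty)\to[0,\infty)$ and maps $f_i:M_i\to N$ ($i\in I$) such that $\lim_{t\to\infty}\rho(t)=\infty$, $\omega(t)<\infty$ for every $t\in[0,\infty)$, and $\rho(t)\le\rho_{f_i}(t)$ and $\omega_{f_i}(t)\le\omega(t)$ for every $i\in I$ and $t\in[0,\infty)$. *)

(* Defs.v *)
From HB Require Import structures.
From mathcomp Require Import all_boot all_order all_algebra.
From mathcomp Require Import all_classical all_reals all_analysis.
Set Implicit Arguments.
Unset Strict Implicit.
Unset Printing Implicit Defensive.
Import Order.TTheory GRing.Theory Num.Theory.
Import numFieldNormedType.Exports.
Local Open Scope classical_set_scope.
Local Open Scope ring_scope.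

Section coarse.
Context {R : realType}.

Definition compression (M N : metricType R) (f : M -> N) (t : R) : \bar R :=
  ereal_inf [set (mdist (f z.1) (f z.2))%:E | z in
    [set z : M * M | t <= mdist z.1 z.2]].

(* [maxe 0] because the supremum is taken in [0, +oo], where the empty set has
   supremum 0, whereas [ereal_sup set0 = -oo]. *)
Definition expansion (M N : metricType R) (f : M -> N) (t : R) : \bar R :=
  maxe 0%E (ereal_sup [set (mdist (f z.1) (f z.2))%:E | z in
    [set z : M * M | mdist z.1 z.2 <= t]]).

(* Only the values of [rho] and [omega] on [0, +oo[ matter; they are finite
   because the functions are real-valued. *)
Definition equi_coarsely_embeds (I : Type) (M : I -> metricType R)
    (N : metricType R) : Prop :=
  exists (rho omega : R -> R) (f : forall i, M i -> N),
    [/\ forall t, 0 <= t -> 0 <= rho t /\ 0 <= omega t,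
        rho t @[t --> +oo] --> +oo &
        forall i t, 0 <= t ->
          ((rho t)%:E <= compression (f i) t)%E /\
          (expansion (f i) t <= (omega t)%:E)%E].

End coarse.

Section graph_distance.
Context {R : realType} {T : eqType} (e : rel T).

Definition is_walk (x y : T) (s : seq T) : Prop := path e x s /\ last x s = y.

Definition graph_dist (x y : T) : R :=
  inf [set (size s)%:R | s in [set s | is_walk x y s]].

Hypothesis e_sym : symmetric e.
Hypothesis e_connected : forall x y, exists s, is_walk x y s.

Lemma graph_dist_le x y s : is_walk x y s -> graph_dist x y <= (size s)%:R.
Proof.
move=> w; apply: ge_inf; last by exists s.
by exists 0 => _ [s' _ <-]; rewrite ler0n.
Qed.

Lemma graph_dist_attained x y :
  exists2 s, is_walk x y s & graph_dist x y = (size s)%:R.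
Proof.
have ex : exists n, `[< exists2 s, is_walk x y s & size s = n >].
  by have [s ws] := e_connected x y; exists (size s); apply/asboolP; exists s.
case: (ex_minnP ex) => n /asboolP[s ws sn] nmin.
exists s => //; apply/eqP; rewrite eq_le graph_dist_le //=.
apply: lb_le_inf; first by exists (size s)%:R, s.
move=> _ [s' ws' <-]; rewrite ler_nat sn; apply: nmin.
by apply/asboolP; exists s'.
Qed.

Lemma graph_distxx x : graph_dist x x = 0.
Proof.
apply/eqP; rewrite eq_le (@graph_dist_le x x [::]) //=.
by have [s _ ->] := graph_dist_attained x x; rewrite ler0n.
Qed.

Lemma graph_dist_eq0 x y : graph_dist x y = 0 -> x = y.
Proof.
have [s [_ <-] ->] := graph_dist_attained x y.
by move/eqP; rewrite pnatr_eq0 size_eq0 => /eqP->.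
Qed.

Lemma is_walk_rev x y s : is_walk x y s ->
  exists2 s', is_walk y x s' & size s' = size s.
Proof.
move=> [ps <-]; exists (rev (belast x s)); last by rewrite size_rev size_belast.
split.
  rewrite rev_path (eq_path (e' := e)) // => u v; exact: e_sym.
by case: s ps => //= a s _; rewrite rev_cons last_rcons.
Qed.

Lemma graph_dist_sym x y : graph_dist x y = graph_dist y x.
Proof.
suff H u v : graph_dist u v <= graph_dist v u.
  by apply/eqP; rewrite eq_le !H.
have [s /is_walk_rev[s' w' <-] ->] := graph_dist_attained v u.
exact: graph_dist_le.
Qed.

Lemma graph_dist_triangle y x z :
  graph_dist x z <= graph_dist x y + graph_dist y z.
Proof.
have [s [ps ls] ->] := graph_dist_attained x y.
have [t [pt lt] ->] := graph_dist_attained y z.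
rewrite -natrD -size_cat; apply: graph_dist_le; split.
  by rewrite cat_path ps ls.
by rewrite last_cat ls.
Qed.

End graph_distance.

(* A k-subset of N is represented by its increasing enumeration, and the least
   element of N is 0.  [R] only serves as the codomain of the distance. *)
Definition kalton (R : realType) (k : nat) : Type :=
  {n : k.-tuple nat | sorted ltn n}.

HB.instance Definition _ R k := Choice.on (kalton R k).

Section kalton_graph.
Context {R : realType} {k : nat}.
Implicit Types m n : kalton R k.

(* [kalton_le n m]: n_1 <= m_1 <= n_2 <= ... <= n_k <= m_k. *)
Definition kalton_le n m : bool :=
  [forall i : 'I_k, tnth (val n) i <= tnth (val m) i]%N &&
  [forall i : 'I_k, forall j : 'I_k,
    (j == i.+1 :> nat) ==> (tnth (val m) i <= tnth (val n) j)%N].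

Definition kalton_adj : rel (kalton R k) :=
  fun m n => (m != n) && (kalton_le n m || kalton_le m n).

Lemma kalton_adj_sym : symmetric kalton_adj.
Proof. by move=> m n; rewrite /kalton_adj eq_sym orbC. Qed.

Lemma kalton_leP n m :
  reflect ((forall i, i < k -> nth 0 (val n) i <= nth 0 (val m) i) /\
           (forall i, i.+1 < k -> nth 0 (val m) i <= nth 0 (val n) i.+1))%N
    (kalton_le n m).
Proof.
apply: (iffP andP) => -[H1 H2]; split.
- move=> i ik; have /forallP/(_ (Ordinal ik)) := H1.
  by rewrite !(tnth_nth 0%N).
- move=> i ik; have /forallP/(_ (Ordinal (ltnW ik))) := H2.
  by move/forallP/(_ (Ordinal ik))/implyP => /(_ (eqxx _)); rewrite !(tnth_nth 0%N).
- by apply/forallP => i; rewrite !(tnth_nth 0%N); exact: H1.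
- apply/forallP => i; apply/forallP => j; apply/implyP => /eqP ji.
  by rewrite !(tnth_nth 0%N) ji; apply: H2; rewrite -ji.
Qed.

Let window_size (s : seq nat) i : size s = (k + k)%N -> (i <= k)%N ->
  size (take k (drop i s)) == k.
Proof.
move=> ss ik; rewrite size_take_min size_drop ss -addnBA ?(leq_trans ik) //.
by apply/eqP/minn_idPl; rewrite leq_addr.
Qed.

Lemma kalton_walk_disjoint (m n : kalton R k) :
  (forall a b, a \in val (val m) -> b \in val (val n) -> (a < b)%N) ->
  exists s, is_walk kalton_adj m n s.
Proof.
move=> mn.
have sm : sorted ltn (val (val m)) := valP m.
have sn : sorted ltn (val (val n)) := valP n.
pose u := val (val m) ++ val (val n).
have su : size u = (k + k)%N by rewrite size_cat !size_tuple.
have uS : sorted ltn u.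
  rewrite sorted_pairwise; last exact: ltn_trans.
  rewrite pairwise_cat -!sorted_pairwise; [|exact: ltn_trans|exact: ltn_trans].
  rewrite sm sn !andbT; apply/allrelP => a b am bn; exact: mn.
have W i : (i <= k)%N -> exists2 w : kalton R k,
    val (val w) = take k (drop i u) & exists s, is_walk kalton_adj m w s.
  elim: i => [_|i IH ik].
    exists m; first by rewrite drop0 take_size_cat // size_tuple.
    by exists [::].
  have [w wE [s [ps ls]]] := IH (ltnW ik).
  have wS : sorted ltn (Tuple (window_size su ik)).
    by rewrite /= take_sorted // drop_sorted.
  pose w' : kalton R k := exist _ (Tuple (window_size su ik)) wS.
  exists w' => //.
  have nw j : (j < k)%N -> nth 0 (val (val w)) j = nth 0%N u (i + j).
    by move=> jk; rewrite wE nth_take // nth_drop.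
  have nw' j : (j < k)%N -> nth 0 (val (val w')) j = nth 0%N u (i + j).+1.
    by move=> jk; rewrite /= nth_take // nth_drop addSn.
  have step j : ((i + j).+1 < size u)%N -> (nth 0%N u (i + j) < nth 0%N u (i + j).+1)%N.
    move=> js; apply: (sorted_ltn_nth ltn_trans 0%N uS); rewrite ?inE //.
    exact: ltnW.
  exists (rcons s w'); split; last by rewrite last_rcons.
  rewrite rcons_path ps ls /kalton_adj andTb.
  have k0 : (0 < k)%N by exact: (leq_ltn_trans (leq0n i) ik).
  have lt0 j : (j < k)%N -> ((i + j).+1 < size u)%N.
    by move=> jk; rewrite su -addSn -addnS leq_add.
  apply/andP; split.
    apply/eqP => ww'; have := step _ (lt0 _ k0).
    by rewrite -nw // -nw' // ww' ltnn.
  apply/orP; right; apply/kalton_leP; split=> j jk.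
    by rewrite nw // nw' // ltnW // step // lt0.
  by rewrite (nw' j) ?(ltnW jk)// nw // addnS.
have [w wE [s ws]] := W k (leqnn k).
suff <- : w = n by exists s.
apply/val_inj/val_inj; rewrite [LHS]wE /u drop_size_cat ?size_tuple //.
by rewrite take_oversize // size_tuple.
Qed.

Lemma kalton_connected m n : exists s, is_walk kalton_adj m n s.
Proof.
pose N := (\max_(a <- val (val m) ++ val (val n)) a).+1.
have lS : sorted ltn (iota_tuple k N) by rewrite /= iota_ltn_sorted.
pose l : kalton R k := exist _ (iota_tuple k N) lS.
have far (x : kalton R k) :
    {subset val (val x) <= val (val m) ++ val (val n)} ->
    exists s, is_walk kalton_adj x l s.
  move=> xs; apply: kalton_walk_disjoint => a b ax.
  rewrite /= mem_iota => /andP[Nb _]; apply: leq_trans Nb.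
  by rewrite ltnS; apply: (@leq_bigmax_seq _ _ xpredT id) => //; exact: xs.
have [|s [ps ls]] := far m; first by move=> a am; rewrite mem_cat am.
have [|t wt] := far n; first by move=> a an; rewrite mem_cat an orbT.
have [t' [pt' lt'] _] := is_walk_rev kalton_adj_sym wt.
exists (s ++ t'); split; first by rewrite cat_path ps ls.
by rewrite last_cat ls.
Qed.

HB.instance Definition _ := @isMetric.Build R (kalton R k)
  (graph_dist kalton_adj)
  (graph_distxx kalton_connected)
  (graph_dist_eq0 kalton_connected)
  (graph_dist_sym kalton_adj_sym kalton_connected)
  (graph_dist_triangle kalton_connected).

End kalton_graph.

Section norm_metric.
Context {R : realType} {V : normedModType R}.

Definition norm_dist (x y : V) : R := `|y - x|.

Lemma norm_dist_ge0 x y : 0 <= norm_dist x y.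
Proof. exact: normr_ge0. Qed.

Lemma norm_dist_positivity x y : norm_dist x y = 0 -> x = y.
Proof. by move/eqP; rewrite normr_eq0 subr_eq0 => /eqP. Qed.

Lemma ball_norm_dist x d : ball x d = [set y | norm_dist x y < d].
Proof.
by rewrite -ball_normE; apply/seteqP; split=> y; rewrite /ball_ /= distrC.
Qed.

End norm_metric.

Section james.
Context {R : realType}.
Implicit Types (x y : nat -> R) (p : R).

(* Sequences are indexed from 0: x(1), x(2), ... are [x 0], [x 1], ...  The
   empty and one-point lists [s] both give the value 0. *)
Definition variation_along p x (s : seq nat) : R :=
  (\sum_(i < (size s).-1) `|x (nth 0%N s i.+1) - x (nth 0%N s i)| `^ p) `^ p^-1.

Definition pvariation p x : \bar R :=
  ereal_sup [set (variation_along p x s)%:E | s in [set s | sorted ltn s]].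

Definition james_pred p : {pred nat -> R} :=
  mem [set x | (pvariation p x < +oo)%E /\ x n @[n --> \oo] --> 0].

Lemma finite_minkowski p (n : nat) (a b : nat -> R) : 1 <= p ->
  (\sum_(i < n) `|a i + b i| `^ p) `^ p^-1 <=
  (\sum_(i < n) `|a i| `^ p) `^ p^-1 + (\sum_(i < n) `|b i| `^ p) `^ p^-1.
Proof.
move=> p1; have p0 : 0 < p by exact: lt_le_trans p1.
pose cut (c : nat -> R) i := if (i < n)%N then c i else 0.
have E c : ('N[counting]_p%:E [EFin \o cut c] =
    ((\sum_(i < n) `|c i| `^ p) `^ p^-1)%:E)%E.
  rewrite Lnorm_counting // -poweR_EFin; congr (_ `^ _)%E.
  rewrite (@nneseries_split _ _ 0 n) => [|k _]; last exact: poweR_ge0.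
  rewrite eseries0 => [|i ni _]; last first.
    by rewrite /= /cut ltnNge ni /= normr0 powR0 // gt_eqF.
  rewrite adde0 add0n big_mkord -sumEFin; apply: eq_bigr => i _.
  by rewrite /= /cut ltn_ord.
have cutD : (cut a \+ cut b)%R = cut (fun i => a i + b i).
  by apply/funext => i; rewrite /= /cut; case: ifP; rewrite ?addr0.
have mcut c : measurable_fun [set: nat] (cut c) by [].
have := @minkowski_EFin _ nat R counting (cut a) (cut b) p (mcut a) (mcut b) p1.
by rewrite cutD (E a) (E b) (E (fun i => a i + b i)) -EFinD lee_fin.
Qed.

Lemma variation_along_ge0 p x s : 0 <= variation_along p x s.
Proof. exact: powR_ge0. Qed.

Lemma variation_alongD p x y s : 1 <= p ->
  variation_along p (x + y) s <= variation_along p x s + variation_along p y s.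
Proof.
move=> p1.
have := @finite_minkowski p (size s).-1
  (fun i => x (nth 0%N s i.+1) - x (nth 0%N s i))
  (fun i => y (nth 0%N s i.+1) - y (nth 0%N s i)) p1.
rewrite /variation_along; under eq_bigr => i _ do rewrite addrACA -opprD.
by [].
Qed.

Lemma variation_alongZ p (a : R) x s : 0 < p ->
  variation_along p (a *: (x : nat -> R^o)) s = `|a| * variation_along p x s.
Proof.
move=> p0; rewrite /variation_along.
under eq_bigr => i _ do rewrite -[_ - _]/(a * _ - a * _) -mulrBr normrM powRM //.
rewrite -mulr_sumr powRM ?powR_ge0 ?sumr_ge0 //.
by rewrite -powRrM mulfV ?gt_eqF // powRr1.
Qed.

Lemma variation_along_le p x s : sorted ltn s ->
  ((variation_along p x s)%:E <= pvariation p x)%E.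
Proof. by move=> ss; apply: ereal_sup_ubound; exists s. Qed.

Lemma pvariation_ge0 p x : (0 <= pvariation p x)%E.
Proof.
apply: le_trans (@variation_along_le p x [::] isT).
by rewrite lee_fin variation_along_ge0.
Qed.

Lemma pvariationD p x y : 1 <= p ->
  (pvariation p (x + y)%R <= pvariation p x + pvariation p y)%E.
Proof.
move=> p1; apply: ge_ereal_sup => _ [s ss <-].
apply: (@le_trans _ _ (variation_along p x s + variation_along p y s)%:E).
  by rewrite lee_fin variation_alongD.
by rewrite EFinD; apply: leeD; exact: variation_along_le.
Qed.

Lemma pvariationZ p (a : R) x : 0 < p ->
  pvariation p (a *: (x : nat -> R^o)) = (`|a|%:E * pvariation p x)%E.
Proof.
move=> p0; rewrite /pvariation -ereal_supZl //; last first.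
  by apply/set0P; exists (variation_along p x [::])%:E, [::].
congr ereal_sup; apply/seteqP; split.
  move=> _ [s ss <-]; exists (variation_along p x s)%:E; first by exists s.
  by rewrite variation_alongZ.
move=> _ [_ [s ss <-] <-]; exists s => //.
by rewrite variation_alongZ.
Qed.

Lemma james_submod_closed p : 1 < p ->
  submod_closed (james_pred p : {pred nat -> R^o}).
Proof.
move=> p1; have p0 : 0 < p by exact: lt_trans p1.
split.
  rewrite inE; split; last exact: cvg_cst.
  have := @pvariationZ p 0 0 p0; rewrite scale0r normr0 mul0e => ->.
  by rewrite ltry.
move=> a x y; rewrite !inE => -[vx lx] [vy ly]; split.
  apply: (le_lt_trans (pvariationD (a *: (x : nat -> R^o)) y (ltW p1))).
  rewrite (pvariationZ a x p0); apply: lte_add_pinfty (vy).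
  apply: lte_mul_pinfty (vx); [by rewrite lee_fin normr_ge0|exact: isT].
have -> : 0 = a * 0 + 0 :> R by rewrite mulr0 addr0.
by apply: cvgD ly; apply: cvgZl_tmp lx.
Qed.

End james.

Record james (R : realType) (p : R) (p1 : 1 < p) := James {
  james_seq :> nat -> R^o;
  _ : james_seq \in james_pred p }.

Section james_normed.
Context {R : realType} {p : R} (p1 : 1 < p).

HB.instance Definition _ := [isSub for @james_seq R p p1].
HB.instance Definition _ := [Choice of james p1 by <:].
HB.instance Definition _ := GRing.isSubmodClosed.Build _ _
  (james_pred p : {pred nat -> R^o}) (james_submod_closed p1).
HB.instance Definition _ := [SubChoice_isSubLmodule of james p1 by <:].

Definition james_norm (x : james p1) : R := fine (pvariation p x).

Let p0 : 0 < p. Proof. exact: lt_trans p1. Qed.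

Lemma james_normE x : (james_norm x)%:E = pvariation p x.
Proof.
rewrite /james_norm fineK // ge0_fin_numE ?pvariation_ge0 //.
by have := valP x; rewrite inE => -[].
Qed.

Lemma james_cvg0 (x : james p1) : x n @[n --> \oo] --> (0 : R).
Proof. by have := valP x; rewrite inE => -[]. Qed.

Lemma ler_james_normD x y : james_norm (x + y) <= james_norm x + james_norm y.
Proof.
have X := james_normE x; have Y := james_normE y.
have XY := james_normE (x + y).
move: (james_norm x) (james_norm y) (james_norm (x + y)) X Y XY => a b c X Y XY.
rewrite -lee_fin EFinD X Y XY.
exact: (@pvariationD _ p x y (ltW p1)).
Qed.

Lemma james_normZ (a : R) x : james_norm (a *: x) = `|a| * james_norm x.
Proof.
have X := james_normE x; have Y := james_normE (a *: x).
move: (james_norm x) (james_norm (a *: x)) X Y => b c X Y.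
apply: EFin_inj; rewrite EFinM X Y.
exact: (@pvariationZ _ p a x p0).
Qed.

Lemma james_norm_eq0 x : james_norm x = 0 -> x = 0.
Proof.
move=> x0; have vx0 s : sorted ltn s -> variation_along p x s = 0.
  move=> ss; apply/eqP; rewrite eq_le variation_along_ge0 andbT -lee_fin.
  by rewrite -x0 james_normE variation_along_le.
have cst n : x n = x 0%N.
  case: n => // n; have := vx0 [:: 0%N; n.+1] isT.
  rewrite /variation_along big_ord1 /= -powRrM mulfV ?gt_eqF // powRr1 //.
  by move/eqP; rewrite normr_eq0 subr_eq0 => /eqP.
apply/val_inj/funext => n; rewrite /= cst.
apply: (@cvg_unique _ _ (x n @[n --> \oo])) => //; last exact: james_cvg0.
have -> : james_seq x = fun=> x 0%N by exact/funext.
exact: cvg_cst.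
Qed.

HB.instance Definition _ := @Lmodule_isNormed.Build R (james p1)
  james_norm ler_james_normD james_normZ james_norm_eq0.
HB.instance Definition _ := @PseudoMetric_isMetric.Build R (james p1)
  norm_dist norm_dist_ge0 norm_dist_positivity ball_norm_dist.

End james_normed.

Section dual.
Context {R : realType} {V : normedModType R}.
Implicit Types f g : V -> R^o.

Definition dual_pred : {pred V -> R^o} :=
  mem [set f | linear f /\ continuous f].

Lemma dual_submod_closed : submod_closed dual_pred.
Proof.
split.
  rewrite inE; split; last by move=> x; exact: cvg_cst.
  by move=> a x y; rewrite /= [0 _]/(0 : R^o) scaler0 addr0.
move=> a f g; rewrite !inE => -[lf cf] [lg cg]; split; last first.
  by move=> x; apply: cvgD; [apply: cvgZr; exact: cf|exact: cg].
move=> b x y; rewrite -[LHS]/(a * f (b *: x + y) + g (b *: x + y)) lf lg.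
rewrite -[LHS]/(a * (b * f x + f y) + (b * g x + g y)).
rewrite -[RHS]/(b * (a * f x + g x) + (a * f y + g y)).
by rewrite !mulrDr !mulrA addrACA (mulrC a).
Qed.

Definition operator_norm f : R := sup [set `|f x| | x in [set x | `|x| <= 1]].

End dual.

Record dual (R : realType) (V : normedModType R) := Dual {
  dual_fun :> V -> R^o;
  _ : dual_fun \in dual_pred }.

Section dual_normed.
Context {R : realType} {V : normedModType R}.

HB.instance Definition _ := [isSub for @dual_fun R V].
HB.instance Definition _ := [Choice of dual V by <:].
HB.instance Definition _ := GRing.isSubmodClosed.Build _ _ (@dual_pred R V)
  dual_submod_closed.
HB.instance Definition _ := [SubChoice_isSubLmodule of dual V by <:].

Implicit Types f g : dual V.

Definition dual_norm f : R := operator_norm f.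

Lemma dual_linear f : linear f.
Proof. by have := valP f; rewrite inE => -[]. Qed.

Lemma dual_continuous f : continuous f.
Proof. by have := valP f; rewrite inE => -[]. Qed.

HB.instance Definition _ f :=
  GRing.isLinear.Build R V R^o _ f (dual_linear f).

Lemma dual_has_sup f : has_sup [set `|f x| | x in [set x | `|x| <= 1]].
Proof.
split; first by exists `|f 0|, 0; rewrite //= normr0 ler01.
have /linear_bounded_continuous/linear_boundedP[M [_ fM]] := @dual_continuous f.
pose r := `|M| + 1; have Mr : M < r.
  by rewrite (le_lt_trans (ler_norm M)) // ltrDl.
exists r => _ [x /= x1 <-]; apply: le_trans (fM r Mr x) _.
by rewrite ler_piMr // addr_ge0.
Qed.

Lemma dual_norm_ge0 f : 0 <= dual_norm f.
Proof.
apply: le_trans (normr_ge0 (f 0)) _; apply: sup_upper_bound (dual_has_sup f) _ _.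
by exists 0; rewrite //= normr0 ler01.
Qed.

Lemma ler_dual_norm f x : `|f x| <= dual_norm f * `|x|.
Proof.
have [->|x0] := eqVneq x 0; first by rewrite linear0 !normr0 mulr0.
have nx : 0 < `|x| by rewrite normr_gt0.
rewrite -ler_pdivrMr //.
have -> : `|f x| / `|x| = `|f (`|x|^-1 *: x)|.
  by rewrite linearZ /= normrM ger0_norm ?invr_ge0 // mulrC.
apply: sup_upper_bound (dual_has_sup f) _ _; exists (`|x|^-1 *: x) => //=.
by rewrite normrZ ger0_norm ?invr_ge0 // mulVf // gt_eqF.
Qed.

Lemma dual_norm_le f M : (forall x, `|x| <= 1 -> `|f x| <= M) -> dual_norm f <= M.
Proof.
move=> fM; apply: ge_sup; first by case: (dual_has_sup f).
by move=> _ [x x1 <-]; exact: fM.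
Qed.

Let ler_norm1 f x : `|x| <= 1 -> `|f x| <= dual_norm f.
Proof. by move=> x1; apply: sup_upper_bound (dual_has_sup f) _ _; exists x. Qed.

Lemma ler_dual_normD f g : dual_norm (f + g) <= dual_norm f + dual_norm g.
Proof.
apply: dual_norm_le => x x1; apply: le_trans (ler_normD _ _) _.
by apply: lerD; exact: ler_norm1.
Qed.

Lemma dual_normZ (a : R) f : dual_norm (a *: f) = `|a| * dual_norm f.
Proof.
have le1 (b : R) g : dual_norm (b *: g) <= `|b| * dual_norm g.
  apply: dual_norm_le => x x1; rewrite -[(b *: g) x]/(b * g x) normrM.
  by apply: ler_wpM2l => //; exact: ler_norm1.
have [->|a0] := eqVneq a 0.
  by apply/eqP; rewrite eq_le le1 normr0 mul0r dual_norm_ge0.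
apply/eqP; rewrite eq_le le1 /= mulrC -ler_pdivlMr ?normr_gt0 //.
have := le1 a^-1 (a *: f).
by rewrite scalerA mulVf // scale1r normfV mulrC.
Qed.

Lemma dual_norm_eq0 f : dual_norm f = 0 -> f = 0.
Proof.
move=> f0; apply/val_inj/funext => x; apply/eqP; rewrite -normr_eq0.
by rewrite eq_le normr_ge0 andbT (le_trans (ler_dual_norm f x)) // f0 mul0r.
Qed.

HB.instance Definition _ := @Lmodule_isNormed.Build R (dual V)
  dual_norm ler_dual_normD dual_normZ dual_norm_eq0.
HB.instance Definition _ := @PseudoMetric_isMetric.Build R (dual V)
  norm_dist norm_dist_ge0 norm_dist_positivity ball_norm_dist.

End dual_normed.

(* Main.v *)
From HB Require Import structures.
From mathcomp Require Import all_boot all_order all_algebra.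
From mathcomp Require Import all_classical all_reals all_analysis.
From mathcomp Require Import zify ring lra.
Require Import Defs.
Set Implicit Arguments.
Unset Strict Implicit.
Unset Printing Implicit Defensive.
Import Order.TTheory GRing.Theory Num.Theory.
Import numFieldNormedType.Exports.
Local Open Scope classical_set_scope.
Local Open Scope ring_scope.

(** Why the theorem holds.  The James space and its dual are both, up to one
    scalar, [l_r]-like for blocks that move to infinity: [r = p] for the James
    space, and [r] is the conjugate exponent for its dual.  The scalar is the
    mass that a bounded sequence loses at infinity.  The record
    [block_structure] states these common features; [james_blocks] and
    [dual_blocks] establish them.

    Let [f] map the [k]-subsets of the natural numbers to such a space, moving
    adjacent subsets by at most [C].  Taking limits along a free ultrafilter,
    one entry after the other, and passing to a sparse sequence of integers,
    one may write [f n] as a fixed vector plus one block for each entry of [n]: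
    the block of the [j]-th entry depends on the first [j] entries, lives near
    the position of the [j]-th one, and has a mass [sigma j] that does not
    depend on [n] ([block_decomposition]).

    If [m] and [n] are interlaced without common entries, then the blocks of
    [f n] and [f m] alternate, and the lower [r]-estimate applied to
    [f n - f m], which has norm at most [C], bounds the sum of the [r]-th powers
    of the norms of the blocks, hence that of the masses, by a constant that
    depends neither on [k] nor on [n] ([even_place_lower], [sigma_lower]).  For
    [k] large compared with [l] there are thus [l] consecutive ranks whose
    masses have a bounded sum ([light_block]).  Let [m] and [n] agree except in
    these ranks, where all entries of [n] precede all those of [m].  In
    [f n - f m] the blocks before these ranks cancel and those after them have
    cancelling masses, so that the upper estimate bounds [f n - f m] by a
    constant that depends neither on [k] nor on [l] ([spread_pair]).  But [m]
    and [n] are at distance at least [l] ([kalton_dist_ge]), and [l] is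
    arbitrary: this is incompatible with an equi-coarse embedding
    ([not_equi_coarsely_embeds]). *)

(** * Powers, weights of intervals, limits along an ultrafilter *)

Section real_powers.
Context {R : realType}.
Implicit Types (r x y : R).

Lemma le_powR r x y : 0 <= r -> 0 <= x -> x <= y -> x `^ r <= y `^ r.
Proof.
by move=> r0 x0 xy; apply: ge0_ler_powR; rewrite ?nnegrE // (le_trans x0).
Qed.

Lemma powR_le_inv r x y : 0 < r -> 0 <= y -> x `^ r <= y `^ r -> x <= y.
Proof.
move=> r0 y0 h; rewrite leNgt; apply/negP => yx.
have := gt0_ltr_powR r0 _ _ yx; rewrite !nnegrE => /(_ y0).
by move=> /(_ (ltW (le_lt_trans y0 yx))); rewrite ltNge h.
Qed.

Lemma powRD_le r x y : 0 <= r -> 0 <= x -> 0 <= y ->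
  (x + y) `^ r <= 2 `^ r * (x `^ r + y `^ r).
Proof.
move=> r0; wlog xy : x y / x <= y.
  move=> H x0 y0; have [xy|/ltW yx] := leP x y; first exact: H.
  by rewrite addrC (addrC (x `^ r)); exact: H.
move=> x0 y0; apply: (@le_trans _ _ ((2 * y) `^ r)).
  by apply: le_powR => //; [exact: addr_ge0 | lra].
rewrite powRM //; apply: ler_wpM2l; first exact: powR_ge0.
by rewrite lerDr powR_ge0.
Qed.

Lemma ler_powR_base r x : 1 <= r -> 1 <= x -> x <= x `^ r.
Proof.
move=> r1 x1; rewrite -[leLHS](powRr1 (le_trans ler01 x1)).
by apply: ler_powR.
Qed.

Lemma sum_even_le (F : nat -> R) n : (forall i, 0 <= F i) ->
  \sum_(j < n) F j.*2 <= \sum_(i < n.*2) F i.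
Proof.
move=> F0; elim: n => [|n IH]; first by rewrite !big_ord0.
rewrite doubleS !big_ord_recr /= -[leLHS]addr0.
by apply: lerD => //; apply: lerD.
Qed.

(** Otherwise one could pick, one after the other, infinitely many disjoint
    intervals of weight more than [e], and their total weight would exceed [K].
    Both the completeness of the coordinatewise limits and the smallness of
    tails come from this. *)
Lemma interval_weight_small (a : nat -> nat -> R) (K : R) :
    (forall M N, 0 <= a M N) ->
    (forall (N : nat -> nat) T, {homo N : i j / (i <= j)%N} ->
      \sum_(i < T) a (N i) (N i.+1) <= K) ->
  forall e, 0 < e -> exists N0, forall M N, (N0 <= M <= N)%N -> a M N <= e.
Proof.
move=> a0 aK e e0; apply: contrapT => /forallNP noN.
have ex N0 : exists MN : nat * nat,
    (N0 <= MN.1 <= MN.2)%N /\ e < a MN.1 MN.2.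
  have /existsNP[M /existsNP[N /not_implyP[MN /negP]]] := noN N0.
  by rewrite -ltNge => aMN; exists (M, N).
have [h hP] := choice ex.
pose s n := iter n (fun m => (h m).2) 0%N.
(* The chosen intervals run from the even to the odd indices of [N]; the steps
   from odd to even indices are gaps. *)
pose N j := if odd j then s j./2.+1 else (h (s j./2)).1.
have Nhomo : {homo N : i j / (i <= j)%N}.
  apply: homo_leq => [//|y x z|j]; first exact: leq_trans.
  rewrite /N /=; case: (boolP (odd j)) => oj /=.
    by rewrite uphalf_half oj add1n; have [/andP[]] := hP (s j./2.+1).
  by rewrite uphalf_half (negbTE oj) add0n /=; have [/andP[]] := hP (s j./2).
have sum_ge n : n%:R * e <= \sum_(j < n) a (N j.*2) (N j.*2.+1).
  elim: n => [|n IH]; first by rewrite big_ord0 mul0r.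
  rewrite big_ord_recr /= -natr1 mulrDl mul1r; apply: lerD => //.
  rewrite /N /= odd_double /= uphalf_half odd_double add0n doubleK /=.
  by have [_ /ltW] := hP (s n).
have [n Kn] : exists n, K < n%:R * e.
  exists (Num.truncn (`|K| / e)).+1; rewrite -ltr_pdivrMr //.
  apply: le_lt_trans (truncnS_gt _); rewrite ler_pM2r ?invr_gt0 //.
  exact: ler_norm.
have := aK N n.*2 Nhomo.
rewrite leNgt => /negP; apply; apply: lt_le_trans Kn _.
apply: le_trans (sum_ge n) _.
exact: (@sum_even_le (fun i => a (N i) (N i.+1))).
Qed.

End real_powers.

Section ultralimit.
Context {R : realType} (U : set_system nat) {UU : UltraFilter U}.
Implicit Types (phi psi : nat -> R).

Definition ulim phi : R := lim (phi n @[n --> U]).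

(** The cluster point given by compactness is a limit, because an ultrafilter
    that meets every neighbourhood contains it. *)
Lemma ultra_cvg phi (K : R) : (\forall n \near U, `|phi n| <= K) ->
  phi n @[n --> U] --> ulim phi.
Proof.
move=> phiK; pose F := phi n @[n --> U].
have FK : F `[- K, K]%classic.
  by near=> n; rewrite /= in_itv /= -ler_norml; near: n.
have [l [_ Fl]] := @segment_compact R (- K) K F _ FK.
suff : F --> l by move=> /cvgP.
move=> V Vl; have [//|UV] := in_ultra_setVsetC (phi @^-1` V) UU.
by have [x [nVx Vx]] := Fl (~` V) V UV Vl.
Unshelve. all: by end_near. Qed.

Lemma ulim_le phi (K : R) : (\forall n \near U, `|phi n| <= K) ->
  `|ulim phi| <= K.
Proof.
move=> phiK; have cphi := cvgP _ (ultra_cvg phiK).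
rewrite ler_norml; apply/andP; split; [apply: limr_ge|apply: limr_le] => //.
  by apply: filterS phiK => n; rewrite ler_norml => /andP[].
by apply: filterS phiK => n; rewrite ler_norml => /andP[].
Qed.

Lemma ulim_near phi (K : R) : (\forall n \near U, `|phi n| <= K) ->
  forall e, 0 < e -> \forall n \near U, `|phi n - ulim phi| <= e.
Proof.
move=> /ultra_cvg /cvgrPdist_le h e /h; apply: filterS => n.
by rewrite distrC.
Qed.

End ultralimit.

Lemma exists_free_ultrafilter :
  exists2 U : set_system nat, UltraFilter U & \oo `<=` U.
Proof. by have [U [UU ooU]] := @ultraFilterLemma nat \oo _; exists U. Qed.

(** * Spaces with a block structure *)

(** What the James space and its dual have in common.  [bproj N] is the
    projection onto the first [N] coordinates, so that
    [bproj b x - bproj a x] is the part of [x] on the interval from [a] to [b].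
    The space behaves like [l_r] with respect to successive blocks, up to one
    scalar defect, the total mass [bmass] of a block: a bounded sequence may
    lose mass at infinity in the coordinatewise limit, and the upper
    [r]-estimate holds up to the sum of the masses of the blocks.  In the James
    space, where the coordinates are the jumps of a sequence vanishing at
    infinity, the mass of [x] is [x 0], up to sign the sum of its jumps; for a
    functional it is its value at the constant sequence 1. *)
Record block_structure (R : realType) (U : set_system nat)
    (X : normedModType R) (r A : R) := BlockStructure {
  bproj : nat -> {linear X -> X};
  bmass : X -> R;
  bconst_ge1 : 1 <= A;
  bexp_ge1 : 1 <= r;
  bproj_proj : forall M N x, bproj M (bproj N x) = bproj (minn M N) x;
  bproj0 : forall x, bproj 0 x = 0;
  bproj_le : forall N x, `|bproj N x| <= A * `|x|;
  bproj_lsc : forall x K, (forall N, `|bproj N x| <= K) -> `|x| <= K;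
  bproj_compact : forall (phi : nat -> X) K,
    (\forall n \near U, `|phi n| <= K) ->
    exists x, forall N e, 0 < e ->
      \forall n \near U, `|bproj N (phi n - x)| <= e;
  bmassB : forall x y, bmass (x - y) = bmass x - bmass y;
  bmass_le : forall x, `|bmass x| <= A * `|x|;
  block_lower : forall (N : nat -> nat) T x, {homo N : i j / (i <= j)%N} ->
    \sum_(i < T) `|bproj (N i.+1) x - bproj (N i) x| `^ r <= (A * `|x|) `^ r;
  block_upper : forall (N : nat -> nat) T (y : nat -> X) K,
    {homo N : i j / (i <= j)%N} -> 0 < K ->
    (forall i, (i < T)%N -> bproj (N i.+1) (y i) - bproj (N i) (y i) = y i) ->
    \sum_(i < T) `|y i| `^ r <= K `^ r ->
    `|\sum_(i < T) y i| <= A * (K + \sum_(i < T) `|bmass (y i)|) }.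

(** * Iterated limits of functions on interlaced tuples *)

Section interlacing.
Local Open Scope nat_scope.
Implicit Types (u v : seq nat).

Definition interlaced u v : Prop := size u = size v /\
  forall i, i < size u ->
    nth 0 u i <= nth 0 v i /\ (i.+1 < size u -> nth 0 v i <= nth 0 u i.+1).

Lemma sorted_rcons u n : sorted ltn u -> last 0 u < n -> sorted ltn (rcons u n).
Proof. by case: u => // a u /= pu lu; rewrite rcons_path pu. Qed.

Lemma interlaced_rcons u v m n : interlaced u v ->
  (u != [::] -> last 0 v <= m) -> m <= n -> interlaced (rcons u m) (rcons v n).
Proof.
move=> [suv uv] vm mn; split; first by rewrite !size_rcons suv.
move=> i; rewrite size_rcons ltnS => iu; rewrite !nth_rcons -suv.
case: ltngtP iu => // [iu _|-> _]; last by split=> //; rewrite ltnn.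
have [h1 h2] := uv i iu; split=> // _.
case: ltngtP => [iu'|ui|iu']; [exact: h2|by rewrite ltnNge iu in ui|].
have -> : nth 0 v i = last 0 v by rewrite -nth_last -suv -iu'.
by apply: vm; case: (u) iu.
Qed.

Lemma interlacedxx u : sorted ltn u -> interlaced u u.
Proof.
move=> su; split=> // i iu; split=> // iu'.
by apply/ltnW/(sorted_ltn_nth ltn_trans); rewrite ?inE.
Qed.

End interlacing.

(** The innermost limit is taken over the last entry of the tuple. *)
Fixpoint ilim (E : Type) (L : (nat -> E) -> E) (h : seq nat -> E) i u : E :=
  if i is i'.+1 then L (fun n => ilim L h i' (rcons u n)) else h u.

Section limits.
Context {R : realType} {X : normedModType R} {U : set_system nat}.
Context {UU : UltraFilter U} (Uoo : \oo `<=` U) {r A : R}.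
Context (B : block_structure U X r A).
Notation P := (bproj B).

Let A1 : 1 <= A. Proof. exact: (bconst_ge1 B). Qed.
Let A0 : 0 < A. Proof. exact: lt_le_trans A1. Qed.
Let r1 : 1 <= r. Proof. exact: (bexp_ge1 B). Qed.
Let r0 : 0 < r. Proof. exact: lt_le_trans r1. Qed.

Lemma near_gt m : \forall n \near U, (m < n)%N.
Proof. by apply: Uoo; exact: nbhs_infty_gt. Qed.

(** By the lower estimate the pieces of [x] on disjoint intervals are
    [r]-summable. *)
Lemma block_tail x e : 0 < e ->
  exists N0, forall N, (N0 <= N)%N -> `|x - P N x| <= e.
Proof.
move=> e0.
have [//|||N0 hN0] := @interval_weight_small R
    (fun M N => `|P N x - P M x| `^ r) ((A * `|x|) `^ r) _ _ (e `^ r).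
- by move=> N T hN; apply: block_lower.
- exact: powR_gt0.
exists N0 => N N0N; apply: (bproj_lsc (b := B)) => M.
rewrite linearB /= bproj_proj; have [MN|NM] := leqP M N.
  by rewrite subrr normr0 ltW.
by apply: (powR_le_inv r0 (ltW e0)); apply: hN0; rewrite N0N ltnW.
Qed.

Definition blim (phi : nat -> X) : X :=
  xget 0 [set x | forall N e, 0 < e ->
    \forall n \near U, `|P N (phi n - x)| <= e].

Lemma blimP phi K : (\forall n \near U, `|phi n| <= K) ->
  forall N e, 0 < e -> \forall n \near U, `|P N (phi n - blim phi)| <= e.
Proof. by move=> /(bproj_compact B) h; exact: (xgetPex 0 h). Qed.

Context (k : nat) (f : seq nat -> X) (C : R).
Hypothesis f_lip : forall u v, size u = k -> sorted ltn u -> sorted ltn v ->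
  interlaced u v -> `|f u - f v| <= C.

(** The iterated limit of [f] over the tuples that extend [u]. *)
Definition blim_at u : X := ilim blim f (k - size u) u.
Notation G := blim_at.

Lemma blim_at_full u : size u = k -> G u = f u.
Proof. by rewrite /G => ->; rewrite subnn. Qed.

Lemma blim_at_rcons u : (size u < k)%N -> G u = blim (fun n => G (rcons u n)).
Proof.
move=> uk; rewrite {1}/G -subnSK //=; congr blim; apply/funext => n.
by rewrite /G size_rcons.
Qed.

(** The existence of the limits at length [j] needs the functions of the last
    entry to be bounded, and this follows from the Lipschitz estimate at length
    [j.+1], applied to two tuples that differ in the last entry; that estimate
    passes in turn to the limit.  It is stated for the projections, so that the
    constant [A * C] does not grow with the number of limits. *)
Let lip_at j := forall u v, size u = j -> sorted ltn u -> sorted ltn v ->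
  interlaced u v -> forall N, `|P N (G u - G v)| <= A * C.

Let cvg_at j := forall u, size u = j -> sorted ltn u ->
  forall N e, 0 < e -> \forall n \near U, `|P N (G (rcons u n) - G u)| <= e.

Let cvg_of_lip j : (j < k)%N -> lip_at j.+1 -> cvg_at j.
Proof.
move=> jk lipj u uj su; rewrite [G u]blim_at_rcons ?uj //.
pose n0 := (last 0%N u).+1.
apply: (@blimP _ (A * C + `|G (rcons u n0)|)).
apply: filterS (near_gt n0) => n n0n.
rewrite -[G (rcons u n)](subrK (G (rcons u n0))).
apply: le_trans (ler_normD _ _) _; rewrite lerD2r distrC.
apply: (bproj_lsc (b := B)) => N; apply: lipj; rewrite ?size_rcons ?uj //.
- exact: sorted_rcons.
- by apply: sorted_rcons => //; apply: ltn_trans n0n; exact: ltnSn.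
- by apply: interlaced_rcons (ltnW n0n) => //; exact: interlacedxx.
Qed.

Let lip_of_lip j : (j < k)%N -> lip_at j.+1 -> lip_at j.
Proof.
move=> jk lipj u v uj su sv uv N; have cvgj := cvg_of_lip jk lipj.
have vj : size v = j by case: uv => <-.
apply/ler_addgt0Pr => e e0; have e20 : 0 < e / 2 by rewrite divr_gt0.
near U => n.
have -> : G u - G v = (G (rcons u n) - G (rcons v n)) -
    (G (rcons u n) - G u) + (G (rcons v n) - G v).
  rewrite opprB [G (rcons u n) - _ + _]addrC !addrA.
  by rewrite !subrK.
rewrite linearD linearB /=; apply: le_trans (ler_normD _ _) _.
rewrite [e]splitr addrA; apply: lerD; last first.
  by near: n; exact: cvgj.
apply: le_trans (ler_normB _ _) _; apply: lerD; last first.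
  by near: n; exact: cvgj.
have un : (last 0 u < n)%N by near: n; exact: near_gt.
have vn : (last 0 v < n)%N by near: n; exact: near_gt.
apply: lipj; rewrite ?size_rcons ?uj //; [exact: sorted_rcons..|].
by apply: interlaced_rcons => // _; exact: ltnW.
Unshelve. all: by end_near. Qed.

Let lip_all j : (j <= k)%N -> lip_at j.
Proof.
move=> jk; rewrite -(subKn jk); elim: (k - j)%N => [|i IH].
  rewrite subn0 => u v uk su sv uv N.
  rewrite !blim_at_full //; last by case: uv => <-.
  apply: le_trans (bproj_le B _ _) _; rewrite ler_pM2l //; exact: f_lip.
have [ik|ki] := ltnP i k; last first.
  by move: IH; rewrite (eqP ki) (eqP (leqW ki)).
by apply: lip_of_lip; rewrite subnSK // leq_subr.
Qed.

Lemma blim_at_cvg u : (size u < k)%N -> sorted ltn u ->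
  forall N e, 0 < e -> \forall n \near U, `|P N (G (rcons u n) - G u)| <= e.
Proof. by move=> uk su; apply: (cvg_of_lip uk) => //; exact: lip_all. Qed.

(** The part of [f] that appears with the last entry of [u]: it escapes to
    infinity as this entry does. *)
Definition bstep u : X := G u - G (take (size u).-1 u).
Notation g := bstep.

Lemma bstep_rcons u n : g (rcons u n) = G (rcons u n) - G u.
Proof. by rewrite /g size_rcons -cats1 take_size_cat. Qed.

Lemma bstep_null u : (size u < k)%N -> sorted ltn u ->
  forall N e, 0 < e -> \forall n \near U, `|P N (g (rcons u n))| <= e.
Proof.
move=> uk su N e e0; apply: filterS (blim_at_cvg uk su N e0) => n.
by rewrite bstep_rcons.
Qed.

Lemma bstep_le u : sorted ltn u -> u != [::] -> (size u <= k)%N ->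
  `|g u| <= A * C.
Proof.
case/lastP: u => // u m su _; rewrite size_rcons bstep_rcons => uk.
have su' : sorted ltn u.
  by move: su; rewrite -cats1; exact: (subseq_sorted ltn_trans (prefix_subseq _ _)).
apply: (bproj_lsc (b := B)) => N; apply/ler_addgt0Pr => e e0.
near U => n.
have -> : G (rcons u m) - G u =
    G (rcons u m) - G (rcons u n) + (G (rcons u n) - G u) by rewrite addrA subrK.
rewrite linearD; apply: le_trans (ler_normD _ _) _; apply: lerD; last first.
  by near: n; exact: blim_at_cvg.
have mn : (m < n)%N by near: n; exact: near_gt.
apply: (lip_all uk) => //; first by rewrite size_rcons.
- apply: sorted_rcons => //; case: (u) su => [_|a w] /=; first exact: leq_ltn_trans mn.
  by rewrite rcons_path => /andP[_ wm]; exact: ltn_trans mn.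
- apply: interlaced_rcons (ltnW mn); first exact: interlacedxx.
  by case: (u) su => // a w /=; rewrite rcons_path => /andP[_ /ltnW].
Unshelve. all: by end_near. Qed.

Lemma blim_at_sum u : (size u <= k)%N ->
  G u = G [::] + \sum_(j < size u) g (take j.+1 u).
Proof.
elim/last_ind: u => [|u n IH]; first by rewrite big_ord0 addr0.
rewrite size_rcons => uk; rewrite big_ord_recr /= take_oversize ?size_rcons //.
rewrite bstep_rcons.
have -> : \sum_(j < size u) g (take j.+1 (rcons u n)) =
    \sum_(j < size u) g (take j.+1 u).
  by apply: eq_bigr => j _; rewrite -cats1 takel_cat.
by rewrite addrA -IH ?(ltnW uk) // addrC subrK.
Qed.

(** The mass of a step need not vanish in the limit.  Off the sorted tuples of
    length at most [k] it is replaced by 0, which makes it globally bounded. *)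
Let h u : R := if sorted ltn u && (u != [::]) && (size u <= k)%N
  then bmass B (g u) else 0.

Let h_le u : `|h u| <= `|A * (A * C)|.
Proof.
rewrite /h; case: ifP => [/andP[/andP[su u0] uk]|_]; last by rewrite normr0.
apply: le_trans (bmass_le B _) _; apply: le_trans (ler_norm _).
by rewrite ler_pM2l // bstep_le.
Qed.

(** Limit of the masses of the steps number [j] of the tuples extending [u]. *)
Definition mass_at j u : R := ilim (ulim U) h (j - size u) u.

Let mass_at_le i u : `|ilim (ulim U) h i u| <= `|A * (A * C)|.
Proof.
elim: i u => [|i IH] u; first exact: h_le.
by apply: ulim_le; near=> n; exact: IH.
Unshelve. all: by end_near. Qed.

Lemma mass_at_full u : sorted ltn u -> u != [::] -> (size u <= k)%N ->
  mass_at (size u) u = bmass B (g u).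
Proof. by move=> su u0 uk; rewrite /mass_at subnn /= /h su u0 uk. Qed.

Lemma mass_at_cvg j u e : (size u < j)%N -> 0 < e ->
  \forall n \near U, `|mass_at j (rcons u n) - mass_at j u| <= e.
Proof.
move=> uj e0.
have bnd : \forall n \near U,
    `|ilim (ulim U) h (j - (size u).+1) (rcons u n)| <= `|A * (A * C)|.
  by near=> n; exact: mass_at_le.
apply: filterS (ulim_near bnd e0) => n.
rewrite /mass_at size_rcons.
by have -> : (j - size u = (j - (size u).+1).+1)%N by rewrite subnSK.
Unshelve. all: by end_near. Qed.

End limits.

(** * Generic sequences *)

Lemma subseq_rcons_cases (T : eqType) (v s : seq T) x : subseq v (rcons s x) ->
  subseq v s \/ exists2 w, v = rcons w x & subseq w s.
Proof.
rewrite -subseq_rev rev_rcons; case E : (rev v) => [|y w] /=.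
  by move=> _; left; rewrite -(revK v) E sub0seq.
case: eqP E => [-> E|_ E] ws; [right|left].
  exists (rev w); last by rewrite -subseq_rev revK.
  by rewrite -(revK v) E rev_cons; congr rcons.
by rewrite -subseq_rev E.
Qed.

Lemma mem_subseq_iota v T i : subseq v (iota 0 T) -> i \in v -> (i < T)%N.
Proof. by move=> vT /(mem_subseq vT); rewrite mem_iota. Qed.

Lemma sorted_map_subseq_iota (t : nat -> nat) v T :
  (forall i j, (i < j < T)%N -> (t i < t j)%N) -> subseq v (iota 0 T) ->
  sorted ltn (map t v).
Proof.
move=> tS vT.
have sv : sorted ltn v := subseq_sorted ltn_trans vT (iota_ltn_sorted 0 T).
apply: (homo_sorted_in (P := mem v)) sv; last exact/allP.
by move=> i j iv jv /= ij; apply: tS; rewrite ij (mem_subseq_iota vT jv).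
Qed.

Section generic.
Context {R : realType} {X : normedModType R} {U : set_system nat}.
Context {UU : UltraFilter U} (Uoo : \oo `<=` U) {r A : R}.
Context (B : block_structure U X r A).
Context (k : nat) (f : seq nat -> X) (C : R).
Hypothesis f_lip : forall u v, size u = k -> sorted ltn u -> sorted ltn v ->
  interlaced u v -> `|f u - f v| <= C.
Notation P := (bproj B).
Notation G := (blim_at B k f).
Notation g := (bstep B k f).
Notation mass_at := (mass_at B k f).

(** Along a sufficiently fast sequence [t], the step of every tuple of entries
    of [t] is concentrated, up to [e], on an interval that depends only on the
    position of its last entry, and intervals of different positions are
    disjoint; the mass of a step is close to its iterated limit. *)
Lemma generic_sequence (e : R) T : 0 < e -> exists t N : nat -> nat,
  [/\ {homo N : i j / (i <= j)%N},
      forall i j, (i < j < T)%N -> (t i < t j)%N &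
      forall v, subseq v (iota 0 T) -> v != [::] -> (size v <= k)%N ->
        [/\ `|P (N (last 0%N v)) (g (map t v))| <= e,
            `|g (map t v) - P (N (last 0%N v).+1) (g (map t v))| <= e &
            forall j, (size v <= j <= k)%N ->
              `|mass_at j (map t v) - mass_at j [::]| <= (size v)%:R * e]].
Proof.
move=> e0; elim: T => [|T [t [N [Nh tS tN]]]].
  exists id, id; split=> // [i j|v]; first by rewrite ltn0 andbF.
  by rewrite subseq0 => /eqP->.
pose V (m : T.-tuple bool) := mask m (iota 0 T).
have VP v : subseq v (iota 0 T) -> exists m, v = V m.
  case/subseqP => m; rewrite size_iota => mT ->.
  by exists (tcast mT (in_tuple m)); rewrite /V val_tcast.
have srt v : subseq v (iota 0 T) -> sorted ltn (map t v).
  exact: sorted_map_subseq_iota.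
(* The new entry [n] is chosen close to its limit behaviour after each of the
   finitely many sublists [V m] of the entries chosen before. *)
near U => n.
have tn i : (i < T)%N -> (t i < n)%N.
  suff H (i' : 'I_T) : (t i' < n)%N by move=> iT; exact: (H (Ordinal iT)).
  by move: i'; near: n; apply: filter_forall => i'; exact: near_gt.
have nullP v : subseq v (iota 0 T) -> (size v < k)%N ->
    `|P (N T) (g (rcons (map t v) n))| <= e.
  suff H (m : T.-tuple bool) : (size (V m) < k)%N ->
      `|P (N T) (g (rcons (map t (V m)) n))| <= e by case/VP=> m ->; exact: H.
  move: m; near: n; apply: filter_forall => m.
  have [mk|] := boolP (size (V m) < k)%N; last by move=> _; near=> n.
  have : \forall n \near U, `|P (N T) (g (rcons (map t (V m)) n))| <= e.
    apply: (bstep_null Uoo B f_lip) => //; rewrite ?size_map //.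
    by apply: srt; exact: mask_subseq.
  by apply: filterS => n.
have massP v j : subseq v (iota 0 T) -> (size v < j <= k)%N ->
    `|mass_at j (rcons (map t v) n) - mass_at j (map t v)| <= e.
  suff H (m : T.-tuple bool) (j' : 'I_k.+1) : (size (V m) < j')%N ->
      `|mass_at j' (rcons (map t (V m)) n) - mass_at j' (map t (V m))| <= e.
    by case/VP=> m -> /andP[mj jk]; exact: (H m (Ordinal (jk : (j < k.+1)%N))).
  move: j'; move: m; near: n; apply: filter_forall => m.
  apply: filter_forall => j'.
  have [mj|] := boolP (size (V m) < j')%N; last by move=> _; near=> n.
  have : \forall n \near U,
      `|mass_at j' (rcons (map t (V m)) n) - mass_at j' (map t (V m))| <= e.
    by apply: (mass_at_cvg Uoo B f_lip) => //; rewrite size_map.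
  by apply: filterS => n.
have tailP (m : T.-tuple bool) : exists M, forall M', (M <= M')%N ->
    `|g (rcons (map t (V m)) n) - P M' (g (rcons (map t (V m)) n))| <= e.
  exact: block_tail.
have [M MP] := choice tailP.
pose t' i := if i == T then n else t i.
pose N1 := maxn (N T) (\max_m M m).
pose N' i := if (i <= T)%N then N i else N1.
have t'E v : subseq v (iota 0 T) -> map t' v = map t v.
  move=> vT; apply/eq_in_map => i /(mem_subseq_iota vT) iT.
  by rewrite /t' ltn_eqF.
exists t', N'; split.
- move=> i j ij; rewrite /N'; case: (leqP j T) => [jT|_].
    by rewrite (leq_trans ij jT); exact: Nh.
  case: (leqP i T) => // iT; apply: leq_trans (leq_maxl _ _); exact: Nh.
- move=> i j /andP[ij]; rewrite ltnS leq_eqVlt => /predU1P[jT|jT].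
    by rewrite /t' jT eqxx ltn_eqF ?tn -?jT.
  by rewrite /t' !ltn_eqF ?(ltn_trans ij) //; apply: tS; rewrite ij.
move=> v; rewrite -addn1 iotaD cats1 add0n => /subseq_rcons_cases[vT|[w -> wT]].
  move=> v0 vk; rewrite t'E //.
  have lT : (last 0%N v < T)%N.
    by apply: (mem_subseq_iota vT); case: (v) v0 => // a w _; exact: mem_last.
  by rewrite /N' lT (ltnW lT); exact: tN.
rewrite size_rcons last_rcons map_rcons t'E // => _ wk.
have -> : t' T = n by rewrite /t' eqxx.
have N'T : N' T = N T by rewrite /N' leqnn.
have N'S : N' T.+1 = N1 by rewrite /N' ltnn.
split.
- by rewrite N'T; exact: nullP.
- rewrite N'S; have [m wm] := VP w wT; rewrite wm; apply: MP.
  by apply: leq_trans (leq_maxr _ _); exact: leq_bigmax.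
- move=> j wj; rewrite -natr1 mulrDl mul1r.
  rewrite -(subrK (mass_at j (map t w)) (mass_at j _)) -addrA [_ + e]addrC.
  apply: le_trans (ler_normD _ _) _; apply: lerD; first exact: massP.
  have [->|w0] := eqVneq w [::]; first by rewrite subrr normr0 mul0r.
  have [_ _] := tN w wT w0 (ltnW wk); apply.
  by move: wj; lia.
Unshelve. all: by end_near. Qed.

(** Truncating the steps to their intervals writes [f], on the tuples of entries
    of [t], as a fixed vector plus one genuine block [D (take j.+1 v)] for each
    entry, whose mass depends, up to [e], only on the rank of the entry. *)
Lemma block_decomposition (e : R) T : 0 < e ->
  exists (t N : nat -> nat) (x0 : X) (sigma : nat -> R) (D : seq nat -> X),
  [/\ {homo N : i j / (i <= j)%N},
      forall i j, (i < j < T)%N -> (t i < t j)%N,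
      forall v, P (N (last 0%N v).+1) (D v) - P (N (last 0%N v)) (D v) = D v,
      forall v, subseq v (iota 0 T) -> (0 < size v <= k)%N ->
        `|bmass B (D v) - sigma (size v)| <= e &
      forall v, subseq v (iota 0 T) -> size v = k ->
        `|f (map t v) - (x0 + \sum_(j < k) D (take j.+1 v))| <= e].
Proof.
move=> e0; have A1 := bconst_ge1 B; have A0 : 0 < A := lt_le_trans ltr01 A1.
(* Truncation costs [d *+ 2] for a step and [A * (d *+ 2)] for its mass, and at
   most [k] steps add up. *)
pose d := e / (2 * A * k.+1%:R).
have d0 : 0 < d by rewrite divr_gt0 // !mulr_gt0 // ltr0n.
have dE : A * (d *+ 2) * k.+1%:R = e.
  rewrite /d -mulr_natr; field.
  by rewrite (gt_eqF A0) andbT nat1r pnatr_eq0.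
have [t [N [Nh tS tN]]] := generic_sequence T d0.
pose D v := P (N (last 0%N v).+1) (g (map t v)) - P (N (last 0%N v)) (g (map t v)).
have gD v : subseq v (iota 0 T) -> (0 < size v <= k)%N ->
    `|g (map t v) - D v| <= d *+ 2.
  move=> vT /andP[v0 vk]; have [|h1 h2 _] := tN v vT _ vk; first by case: (v) v0.
  by rewrite /D opprB addrCA addrC; apply: le_trans (ler_normD _ _) _; exact: lerD.
exists t, N, (G [::]), (mass_at ^~ [::]), D; split=> //.
- move=> v; rewrite /D; move: (g _) => y; rewrite !raddfB /= !bproj_proj !minnn.
  have Nl : (N (last 0%N v) <= N (last 0%N v).+1)%N by exact: Nh.
  by rewrite (minn_idPl Nl) (minn_idPr Nl) subrr addr0.
- move=> v vT vk; have [v0 vk'] := andP vk.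
  have v0' : v != [::] by case: (v) v0.
  have sv : sorted ltn (map t v) by exact: sorted_map_subseq_iota vT.
  have [_ _ /(_ (size v))] := tN v vT v0' vk'.
  rewrite leqnn vk' => /(_ isT).
  rewrite -[in mass_at _ (map t v)](size_map t v) mass_at_full ?size_map //; last first.
    by case: (v) v0'.
  move=> hm; rewrite distrC -(subrK (bmass B (g (map t v))) (mass_at _ _)) -addrA.
  rewrite -bmassB; apply: le_trans (ler_normD _ _) _.
  rewrite [leLHS]addrC distrC -dE -natr1 mulrDr mulr1 addrC; apply: lerD.
    apply: le_trans hm _; rewrite mulrC; apply: ler_pM => //.
    - exact: ltW.
    - apply: (@le_trans _ _ (d *+ 2)); first by rewrite mulr2n lerDl ltW.
      by rewrite ler_peMl // mulrn_wge0 // ltW.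
    - by rewrite ler_nat.
  by apply: le_trans (bmass_le B _) _; rewrite ler_pM2l // gD.
- move=> v vT vk; rewrite -(blim_at_full B (k := k)) ?size_map // blim_at_sum ?size_map ?vk //.
  rewrite opprD addrACA subrr add0r -sumrB.
  apply: le_trans (ler_norm_sum _ _ _) _; apply: le_trans (_ : _ <= \sum_(j < k) d *+ 2) _.
    apply: ler_sum => j _; rewrite -map_take gD //.
      exact: subseq_trans (take_subseq _ _) vT.
    by rewrite size_takel ?vk ?ltn_ord.
  rewrite sumr_const card_ord -dE -[leLHS]mulr_natr; apply: ler_pM => //.
  - by rewrite mulrn_wge0 // ltW.
  - by rewrite ler_peMl ?mulrn_wge0 // ltW.
  - by rewrite ler_nat.
Qed.

End generic.

(** * Blocks placed at positions *)

Section positions.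
Implicit Types (T k : nat).

Lemma sorted_subseq_iota v T : sorted ltn v -> (forall i, i \in v -> i < T)%N ->
  subseq v (iota 0 T).
Proof.
move=> sv vT; have -> : v = [seq i <- iota 0 T | i \in v].
  apply: (irr_sorted_eq ltn_trans ltnn) => //.
    exact: (sorted_filter ltn_trans) (iota_ltn_sorted 0 T).
  move=> i; rewrite mem_filter mem_iota /= add0n.
  by case: (boolP (i \in v)) => // /vT ->.
exact: filter_subseq.
Qed.

Lemma sorted_mkseq (a : nat -> nat) k :
  (forall i j, (i < j < k)%N -> (a i < a j)%N) -> sorted ltn (mkseq a k).
Proof.
move=> ha; apply: (homo_sorted_in (P := gtn k)) (iota_ltn_sorted 0 k).
  by move=> i j ik jk /= ij; apply: ha; rewrite ij.
by apply/allP => i; rewrite mem_iota.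
Qed.

Lemma mkseq_subseq_iota (a : nat -> nat) k T :
  (forall i j, (i < j < k)%N -> (a i < a j)%N) ->
  (forall i, (i < k)%N -> (a i < T)%N) -> subseq (mkseq a k) (iota 0 T).
Proof.
move=> ha aT; apply: sorted_subseq_iota; first exact: sorted_mkseq.
by move=> i /mapP[j]; rewrite mem_iota => jk ->; exact: aT.
Qed.

Lemma interlaced_mkseq (a b : nat -> nat) k :
  (forall i, (i < k)%N -> (a i <= b i)%N) ->
  (forall i, (i.+1 < k)%N -> (b i <= a i.+1)%N) ->
  interlaced (mkseq a k) (mkseq b k).
Proof.
move=> ab ba; split; rewrite !size_mkseq // => i ik.
by rewrite !(nth_mkseq _ _ ik); split=> [|ik']; rewrite ?nth_mkseq //; auto.
Qed.

(** Leaves out the [l] positions from [b] on. *)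
Definition skip b l j := (if j < b then j else j + l)%N.

Lemma skip_lt b l i j : (i < j)%N -> (skip b l i < skip b l j)%N.
Proof. by rewrite /skip; case: (ltnP i b); case: (ltnP j b); lia. Qed.

Lemma skip_bound b l k i : (i < k)%N -> (skip b l i < k + l)%N.
Proof. by rewrite /skip; case: (ltnP i b); lia. Qed.

Lemma skip_neq b l j : skip (b + l) l j != skip b l j -> (b <= j < b + l)%N.
Proof.
by rewrite /skip; case: (ltnP j b); case: (ltnP j (b + l)); rewrite ?eqxx //; lia.
Qed.

Lemma skip_end b l s : (s < l)%N -> (skip (b + l) l (b + s) < skip b l b)%N.
Proof. by rewrite /skip ltnn => sl; rewrite ltn_add2l sl ltn_add2l. Qed.

Lemma ltn_double_succ m n : (m < n)%N -> (m.*2.+1 < n.*2)%N.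
Proof. by lia. Qed.

Lemma sum_pick (V : nmodType) T i0 (c : V) : (i0 < T)%N ->
  \sum_(i < T) (if i0 == i then c else 0) = c.
Proof.
move=> iT; rewrite (bigD1 (Ordinal iT)) //= eqxx big1 ?addr0 // => i ne.
by case: eqP => // E; case/eqP: ne; apply/val_inj.
Qed.

End positions.

Section placement.
Context {R : realType} {X : normedModType R} {U : set_system nat} {r A : R}.
Context (B : block_structure U X r A).
Notation P := (bproj B).
Notation mass := (bmass B).

Let A1 : 1 <= A. Proof. exact: (bconst_ge1 B). Qed.
Let A0 : 0 < A. Proof. exact: lt_le_trans A1. Qed.
Let r1 : 1 <= r. Proof. exact: (bexp_ge1 B). Qed.
Let r0 : 0 < r. Proof. exact: lt_le_trans r1. Qed.

Lemma bmass_sum n (y : 'I_n -> X) : mass (\sum_i y i) = \sum_i mass (y i).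
Proof.
have m0 : mass 0 = 0 by rewrite -(subrr 0) bmassB subrr.
have mD a b : mass (a + b) = mass a + mass b.
  by rewrite -{1}[b]opprK -[- b]sub0r !bmassB m0 sub0r opprK.
exact: (big_morph _ mD m0).
Qed.

Context (N : nat -> nat) (Nh : {homo N : i j / (i <= j)%N}).

Lemma block_coord T (y : nat -> X) i :
  (forall j, P (N j.+1) (y j) - P (N j) (y j) = y j) -> (i < T)%N ->
  P (N i.+1) (\sum_(j < T) y j) - P (N i) (\sum_(j < T) y j) = y i.
Proof.
move=> yP iT; rewrite !raddf_sum. rewrite -big_split /= (bigD1 (Ordinal iT)) //= yP.
rewrite big1 ?addr0 // => j /eqP ji; rewrite -[y j]yP.
rewrite (raddfB (P (N i.+1))) (raddfB (P (N i))) /= !bproj_proj.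
have [ij|jI|E] := ltngtP i j; last by case: ji; apply/val_inj.
  have h1 : (N i <= N j)%N by apply: Nh; exact: ltnW.
  have h2 : (N i.+1 <= N j)%N by exact: Nh.
  have h3 : (N j <= N j.+1)%N by exact: Nh.
  rewrite (minn_idPl (leq_trans h2 h3)) (minn_idPl h2) subrr.
  by rewrite (minn_idPl (leq_trans h1 h3)) (minn_idPl h1) subrr subr0.
have h1 : (N j.+1 <= N i)%N by exact: Nh.
have h2 : (N i <= N i.+1)%N by exact: Nh.
have h3 : (N j <= N j.+1)%N by exact: Nh.
rewrite !(minn_idPr _) ?subrr //; lia.
Qed.

Context (D : seq nat -> X).
Hypothesis D_block : forall v,
  P (N (last 0%N v).+1) (D v) - P (N (last 0%N v)) (D v) = D v.

(** Positions serve as a common index set for the blocks of two tuples, so that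
    blocks at the same position can be compared. *)
Definition place v i : X :=
  \sum_(j < size v) if nth 0%N v j == i then D (take j.+1 v) else 0.

Lemma place_block v i :
  P (N i.+1) (place v i) - P (N i) (place v i) = place v i.
Proof.
rewrite /place !raddf_sum -big_split /=; apply: eq_bigr => j _.
case: eqP => [<-|_]; last by rewrite !linear0 addr0.
have := D_block (take j.+1 v).
by rewrite -nth_last size_takel //= nth_take.
Qed.

Lemma place_sum v T : (forall i, i \in v -> (i < T)%N) ->
  \sum_(i < T) place v i = \sum_(j < size v) D (take j.+1 v).
Proof.
move=> vT; rewrite exchange_big /=; apply: eq_bigr => j _.
by rewrite sum_pick // vT // mem_nth.
Qed.

Lemma place_nth v j : uniq v -> (j < size v)%N ->
  place v (nth 0%N v j) = D (take j.+1 v).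
Proof.
move=> uv jv; rewrite /place (bigD1 (Ordinal jv)) //= eqxx big1 ?addr0 // => i.
by rewrite nth_uniq // => /negbTE ij; case: ifP => // E; move: ij; rewrite -val_eqE /= E.
Qed.

Lemma place_notin v i : i \notin v -> place v i = 0.
Proof.
move=> iv; rewrite /place big1 // => j _; case: eqP => // E.
by move: iv; rewrite -E mem_nth.
Qed.

Lemma place_blockB v w i :
  P (N i.+1) (place v i - place w i) - P (N i) (place v i - place w i) =
  place v i - place w i.
Proof.
rewrite (raddfB (P (N i.+1))) (raddfB (P (N i))) opprB.
rewrite [P (N i) _ - _]addrC addrACA place_block [- _ + _]addrC -opprB.
by rewrite place_block.
Qed.

(** As no block of [w] lies at a position of [v], the blocks of [v] are blocks of
    the difference of the two sums, and the lower estimate applies to it. *)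
Lemma place_lower v w T K : (forall i, i \in v -> i \notin w) ->
  `|\sum_(i < T) place v i - \sum_(i < T) place w i| <= K ->
  \sum_(i < T) `|place v i| `^ r <= (A * K) `^ r.
Proof.
move=> vw hK; rewrite -sumrB in hK.
apply: (@le_trans _ _ ((A * `|\sum_(i < T) (place v i - place w i)|) `^ r)).
  apply: le_trans (block_lower B T _ Nh).
  apply: ler_sum => i _; apply: le_powR => //; first exact: ltW.
  have /= -> := @block_coord T (fun i => place v i - place w i) i _ (ltn_ord i).
    have [iv|iv] := boolP (nat_of_ord i \in v).
      by rewrite [place w i]place_notin ?subr0 // vw.
    by rewrite place_notin // normr0.
  by move=> j; exact: place_blockB.
apply: le_powR; rewrite ?mulr_ge0 ?normr_ge0 ?(ltW A0) ?(ltW r0) //.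
by rewrite ler_pM2l.
Qed.

(** Entries of the same rank at the same position have nearly equal masses, which
    cancel; the other ones are estimated separately. *)
Lemma place_mass (v w : seq nat) T k (sigma : nat -> R) e :
  size v = k -> size w = k -> (forall i, i \in v -> (i < T)%N) ->
  (forall i, i \in w -> (i < T)%N) ->
  (forall j, (j < k)%N -> `|mass (D (take j.+1 v)) - sigma j| <= e) ->
  (forall j, (j < k)%N -> `|mass (D (take j.+1 w)) - sigma j| <= e) ->
  \sum_(i < T) `|mass (place v i - place w i)| <=
  (e *+ 2) *+ k + \sum_(j < k) if nth 0%N v j == nth 0%N w j then 0
    else `|sigma j| *+ 2.
Proof.
move=> vk wk vT wT hv hw.
pose a j := mass (D (take j.+1 v)); pose b j := mass (D (take j.+1 w)).
pose d i j := (if nth 0%N v j == i then a j else 0) -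
  (if nth 0%N w j == i then b j else 0).
have m0 : mass 0 = 0 by rewrite -(subrr 0) bmassB subrr.
have massE i : mass (place v i - place w i) = \sum_(j < k) d i j.
  rewrite bmassB /place vk wk !bmass_sum -sumrB; apply: eq_bigr => j _.
  by rewrite /d /a /b; case: eqP => _; case: eqP => _; rewrite ?m0.
apply: (@le_trans _ _ (\sum_(i < T) \sum_(j < k) `|d i j|)).
  by apply: ler_sum => i _; rewrite massE ler_norm_sum.
have -> : (e *+ 2) *+ k = \sum_(j < k) e *+ 2 by rewrite sumr_const card_ord.
rewrite exchange_big -big_split /=; apply: ler_sum => j _.
have jv : (nth 0%N v j < T)%N by apply: vT; rewrite mem_nth ?vk.
have jw : (nth 0%N w j < T)%N by apply: wT; rewrite mem_nth ?wk.
have ha : `|a j - sigma j| <= e := hv j (ltn_ord j).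
have hb : `|b j - sigma j| <= e := hw j (ltn_ord j).
case: eqP => [E|_].
  rewrite (eq_bigr (fun i : 'I_T => if nth 0%N v j == i then `|a j - b j| else 0)).
    rewrite sum_pick // addr0 -(subrK (sigma j) (a j)) -addrA mulr2n.
    by apply: le_trans (ler_normD _ _) _; apply: lerD => //; rewrite distrC.
  by move=> i _; rewrite /d -E; case: ifP => // _; rewrite subr0 normr0.
apply: (@le_trans _ _ (\sum_(i < T) ((if nth 0%N v j == i then `|a j| else 0) +
    (if nth 0%N w j == i then `|b j| else 0)))).
  apply: ler_sum => i _; apply: le_trans (ler_normB _ _) _.
  by apply: lerD; case: ifP; rewrite ?normr0.
rewrite big_split /= !sum_pick // !mulr2n addrACA.
have bound c : `|c - sigma j| <= e -> `|c| <= e + `|sigma j|.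
  move=> h; rewrite -{1}(subrK (sigma j) c).
  by apply: le_trans (ler_normD _ _) _; rewrite lerD2r.
by apply: lerD; exact: bound.
Qed.

End placement.

(** * Two far apart tuples with close images *)

(** Otherwise each of the [q] blocks of length [l] contains an entry larger than
    [M / l], which is more than the sum of powers allows. *)
Lemma light_block (R : realType) (sigma : nat -> R) (r M : R) (q l : nat) :
  0 < r -> 0 < M -> (0 < l)%N -> l%:R `^ r < q%:R ->
  \sum_(j < q * l) `|sigma j| `^ r <= M `^ r ->
  exists2 h, (h < q)%N & \sum_(h * l <= j < h.+1 * l) `|sigma j| <= M.
Proof.
move=> r0 M0 l0 lq sM; apply: contrapT => noh.
have l0' : 0 < l%:R :> R by rewrite ltr0n.
have heavy h : (h < q)%N ->
    (M / l%:R) `^ r <= \sum_(h * l <= j < h.+1 * l) `|sigma j| `^ r.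
  move=> hq; rewrite leNgt; apply/negP => small; apply: noh; exists h => //.
  apply: (@le_trans _ _ (\sum_(h * l <= j < h.+1 * l) M / l%:R)).
    apply: ler_sum_nat => j jh.
    apply: (powR_le_inv r0); first by rewrite divr_ge0 ?ltW.
    apply: le_trans (ltW small).
    rewrite (bigD1_seq j) ?mem_index_iota ?iota_uniq //= lerDl.
    by apply: sumr_ge0 => i _; exact: powR_ge0.
  by rewrite sumr_const_nat mulSn addnK -[leLHS]mulr_natr divfK ?gt_eqF.
move: sM; rewrite leNgt => /negP; apply.
rewrite -(big_mkord xpredT (fun j => `|sigma j| `^ r)) big_nat_mul.
apply: (@lt_le_trans _ _ (\sum_(0 <= h < q) (M / l%:R) `^ r)); last first.
  apply: ler_sum_nat => h /andP[_ hq].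
  exact: heavy.
have Ml0 : 0 < (M / l%:R) `^ r by rewrite powR_gt0 // divr_gt0.
rewrite sumr_const_nat subn0 -[ltRHS]mulr_natl.
have -> : M `^ r = l%:R `^ r * (M / l%:R) `^ r.
  by rewrite -powRM ?ltW ?divr_gt0 // mulrC divfK ?gt_eqF.
by rewrite ltr_pM2r.
Qed.

Section spread.
Context {R : realType} {X : normedModType R} {U : set_system nat} {r A : R}.
Context (B : block_structure U X r A).
Context (k l : nat) (f : seq nat -> X) (C : R).
Hypothesis C1 : 1 <= C.
Hypothesis f_lip : forall u v, size u = k -> sorted ltn u -> sorted ltn v ->
  interlaced u v -> `|f u - f v| <= C.
Notation P := (bproj B).
Notation T := (k + l).*2.

(* The output of [block_decomposition], for a small error [e]. *)
Context (e : R) (t N : nat -> nat) (x0 : X) (sigma : nat -> R).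
Context (D : seq nat -> X).
Hypothesis e0 : 0 < e.
Hypothesis ek : (e *+ 2) *+ k = 1.
Hypothesis Nh : {homo N : i j / (i <= j)%N}.
Hypothesis tS : forall i j, (i < j < T)%N -> (t i < t j)%N.
Hypothesis D_block : forall v,
  P (N (last 0%N v).+1) (D v) - P (N (last 0%N v)) (D v) = D v.
Hypothesis D_mass : forall v, subseq v (iota 0 T) -> (0 < size v <= k)%N ->
  `|bmass B (D v) - sigma (size v)| <= e.
Hypothesis fD : forall v, subseq v (iota 0 T) -> size v = k ->
  `|f (map t v) - (x0 + \sum_(j < k) D (take j.+1 v))| <= e.

Let A1 : 1 <= A. Proof. exact: (bconst_ge1 B). Qed.
Let A0 : 0 < A. Proof. exact: lt_le_trans A1. Qed.
Let r1 : 1 <= r. Proof. exact: (bexp_ge1 B). Qed.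
Let r0 : 0 < r. Proof. exact: lt_le_trans r1. Qed.
Let C0 : 0 < C. Proof. exact: lt_le_trans C1. Qed.
Let L := A * (2 * C).
Let L0 : 0 < L. Proof. by rewrite !mulr_gt0. Qed.
Let L1 : 1 <= L. Proof. by rewrite /L; have := A1; have := C1; nra. Qed.
Let M := 4 * (A * L).
Let M0 : 0 < M. Proof. by rewrite !mulr_gt0. Qed.

Let k0 : (0 < k)%N.
Proof.
rewrite lt0n; apply/eqP => k0; move: ek; rewrite k0 mulr0n => /eqP.
by rewrite eq_sym oner_eq0.
Qed.

Let e21 : e *+ 2 <= 1.
Proof.
by rewrite -ek -[leRHS]mulr_natr ler_peMr ?mulrn_wge0 ?(ltW e0) // ler1n.
Qed.

Let e1 : e <= 1.
Proof. by apply: le_trans e21; rewrite mulr2n lerDl ltW. Qed.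

Let D_mass_take v j : subseq v (iota 0 T) -> size v = k -> (j < k)%N ->
  `|bmass B (D (take j.+1 v)) - sigma j.+1| <= e.
Proof.
move=> vT vk jk; have := D_mass (v := take j.+1 v).
rewrite size_takel ?vk // jk; apply => //.
exact: subseq_trans (take_subseq _ _) vT.
Qed.

Lemma map_mkseq_sorted (a : nat -> nat) :
  (forall i j, (i < j < k)%N -> (a i < a j)%N) ->
  (forall i, (i < k)%N -> (a i < T)%N) ->
  sorted ltn (mkseq (t \o a) k).
Proof.
move=> aS aT; apply: sorted_mkseq => i j ij /=; apply: tS; rewrite aS //=.
by apply: aT; case/andP: ij.
Qed.

Lemma map_mkseq (a : nat -> nat) : map t (mkseq a k) = mkseq (t \o a) k.
Proof. by rewrite /mkseq -map_comp. Qed.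

Lemma place_approx v w : subseq v (iota 0 T) -> subseq w (iota 0 T) ->
  size v = k -> size w = k ->
  `|(f (map t v) - f (map t w)) -
    (\sum_(i < T) place D v i - \sum_(i < T) place D w i)| <= 1.
Proof.
move=> vT wT vk wk; rewrite !place_sum ?vk ?wk; last 2 first.
- by move=> i; exact: mem_subseq_iota.
- by move=> i; exact: mem_subseq_iota.
have := fD vT vk; have := fD wT wk.
set fv := f _; set fw := f (map t v).
set sv := \sum_(j < k) _; set sw := \sum_(j < k) D (take j.+1 v).
move=> h1 h2; apply: le_trans e21; rewrite mulr2n.
have -> : fw - fv - (sw - sv) = (fw - (x0 + sw)) - (fv - (x0 + sv)).
  rewrite !opprB [x0 + sv - _]addrC [RHS]addrACA [- (x0 + sw) + _]addrC.
  by rewrite opprD [x0 + sv + _]addrACA subrr add0r.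
by apply: le_trans (ler_normB _ _) _; exact: lerD.
Qed.

(** Even positions leave room for an interlaced tuple at the following odd
    positions.  Its image is close by, and it has no block in common with the
    given tuple, so all blocks of the latter are seen in the difference. *)
Lemma even_place_lower (a : nat -> nat) :
  (forall i j, (i < j < k)%N -> (a i < a j)%N) ->
  (forall i, (i < k)%N -> (a i < k + l)%N) ->
  \sum_(i < T) `|place D (mkseq (double \o a) k) i| `^ r <= L `^ r.
Proof.
move=> aS aT; pose v := mkseq (double \o a) k.
pose w := mkseq (succn \o (double \o a)) k.
have vS i j : (i < j < k)%N -> ((double \o a) i < (double \o a) j)%N.
  by move=> /aS /=; rewrite ltn_double.
have wS i j : (i < j < k)%N ->
    ((succn \o (double \o a)) i < (succn \o (double \o a)) j)%N.
  by move=> /vS.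
have vT i : (i < k)%N -> ((double \o a) i < T)%N.
  by move=> /aT /=; rewrite ltn_double.
have wT i : (i < k)%N -> ((succn \o (double \o a)) i < T)%N.
  by move=> /aT /=; exact: ltn_double_succ.
have sv := mkseq_subseq_iota vS vT; have sw := mkseq_subseq_iota wS wT.
apply: (place_lower Nh D_block (w := w)).
  move=> i /mapP[j _ ->]; apply/mapP => -[j' _ /= E].
  by have := congr1 odd E; rewrite /= !odd_double.
have := place_approx sv sw; rewrite !size_mkseq => /(_ erefl erefl).
rewrite distrC => h; rewrite -[X in `|X|](subrK (f (map t v) - f (map t w))).
apply: le_trans (ler_normD _ _) _; rewrite mulr_natl mulr2n; apply: lerD.
  exact: le_trans h C1.
rewrite !map_mkseq; apply: f_lip; rewrite ?size_mkseq //.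
- exact: map_mkseq_sorted.
- exact: map_mkseq_sorted.
- apply: interlaced_mkseq => i ik /=; first by apply/ltnW/tS; rewrite ltnSn wT.
  apply/ltnW/tS; rewrite vT // andbT; apply: ltn_double_succ.
  by apply: aS; rewrite ltnSn.
Qed.

(** A mass is at most a multiple of the norm of its block. *)
Lemma sigma_lower : \sum_(j < k) `|sigma j.+1| `^ r <= M `^ r.
Proof.
pose v := mkseq (double \o id) k.
have idk i : (i < k)%N -> (i < k + l)%N by exact: ltn_addr.
have vT : subseq v (iota 0 T).
  apply: mkseq_subseq_iota => [i j /andP[ij _]|i /idk] /=.
    by rewrite ltn_double.
  by rewrite ltn_double.
have sum_v : \sum_(j < k) `|D (take j.+1 v)| `^ r <= L `^ r.
  apply: le_trans (@even_place_lower id _ idk); last by move=> i j /andP[].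
  apply: (@le_trans _ _ (\sum_(i < k.*2) `|place D v i| `^ r)); last first.
    rewrite doubleD big_split_ord /= lerDl.
    by apply: sumr_ge0 => i _; exact: powR_ge0.
  apply: le_trans (sum_even_le (F := fun i => `|place D v i| `^ r) k
    (fun=> powR_ge0 _ _)).
  apply: ler_sum => j _; have uv : uniq v.
    exact: subseq_uniq vT (iota_uniq _ _).
  by rewrite -(place_nth D uv) ?size_mkseq // nth_mkseq.
apply: (@le_trans _ _
    (\sum_(j < k) 2 `^ r * ((A * `|D (take j.+1 v)|) `^ r + e))).
  apply: ler_sum => j _.
  have sj : `|sigma j.+1| <= A * `|D (take j.+1 v)| + e.
    rewrite -(subrK (bmass B (D (take j.+1 v))) (sigma j.+1)) addrC.
    apply: le_trans (ler_normD _ _) _; apply: lerD; first exact: bmass_le.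
    by rewrite distrC D_mass_take // size_mkseq.
  apply: (@le_trans _ _ ((A * `|D (take j.+1 v)| + e) `^ r)).
    by apply: le_powR => //; exact: ltW.
  apply: le_trans (powRD_le _ _ _) _; rewrite ?(ltW r0) ?(ltW e0) //.
    by rewrite mulr_ge0 // ltW.
  rewrite ler_pM2l ?powR_gt0 // lerD2l -[leRHS](powRr1 (ltW e0)).
  by apply: ger_powR => //; rewrite e0.
rewrite -mulr_sumr big_split /= sumr_const card_ord.
have -> : M `^ r = 2 `^ r * (2 `^ r * (A * L) `^ r).
  have AL0 : 0 <= A * L := mulr_ge0 (ltW A0) (ltW L0).
  have AL0' : 0 <= 2 * (A * L) by exact: mulr_ge0.
  by rewrite /M -!powRM //; congr (_ `^ _); ring.
rewrite ler_pM2l ?powR_gt0 //.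
have AL1 : 1 <= (A * L) `^ r.
  by apply: le_trans (ler_powR_base r1 _); have := A1; have := L1; nra.
apply: (@le_trans _ _ (2 * (A * L) `^ r)); last first.
  by rewrite ler_pM2r ?ler_powR_base ?ler1n // (lt_le_trans ltr01).
rewrite mulr_natl mulr2n; apply: lerD.
  rewrite (eq_bigr (fun j : 'I_k => A `^ r * `|D (take j.+1 v)| `^ r)).
    by rewrite -mulr_sumr powRM ?(ltW A0) ?(ltW L0) // ler_pM2l ?powR_gt0.
  by move=> j _; rewrite powRM // ltW.
apply: le_trans AL1; rewrite -ek; apply: ler_wMn2r.
by rewrite mulr2n lerDl ltW.
Qed.

(** Where the masses from rank [b] to [b + l] have a bounded sum, the [l]
    entries of these ranks can be moved past each other at bounded cost: the
    other blocks cancel or have cancelling masses. *)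
Lemma spread_pair b : (0 < l)%N -> (b + l <= k)%N ->
  \sum_(b <= j < b + l) `|sigma j.+1| <= M ->
  exists u v, [/\ size u = k /\ size v = k, sorted ltn u /\ sorted ltn v,
    forall s, (s < l)%N -> (nth 0 u (b + s) < nth 0 v b)%N &
    `|f u - f v| <= 1 + A * (4 * L + (1 + M *+ 2))].
Proof.
move=> l0 bl sM; pose a1 := skip (b + l) l; pose a2 := skip b l.
have a1S i j : (i < j < k)%N -> (a1 i < a1 j)%N by case/andP=> *; exact: skip_lt.
have a2S i j : (i < j < k)%N -> (a2 i < a2 j)%N by case/andP=> *; exact: skip_lt.
have a1T i : (i < k)%N -> (a1 i < k + l)%N by exact: skip_bound.
have a2T i : (i < k)%N -> (a2 i < k + l)%N by exact: skip_bound.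
have evS (a : nat -> nat) : (forall i j, (i < j < k)%N -> (a i < a j)%N) ->
    forall i j, (i < j < k)%N -> ((double \o a) i < (double \o a) j)%N.
  by move=> aS i j /aS /=; rewrite ltn_double.
have evT (a : nat -> nat) : (forall i, (i < k)%N -> (a i < k + l)%N) ->
    forall i, (i < k)%N -> ((double \o a) i < T)%N.
  by move=> aT i /aT /=; rewrite ltn_double.
pose v1 := mkseq (double \o a1) k; pose v2 := mkseq (double \o a2) k.
have v1T : subseq v1 (iota 0 T) by apply: mkseq_subseq_iota; auto.
have v2T : subseq v2 (iota 0 T) by apply: mkseq_subseq_iota; auto.
exists (map t v1), (map t v2); split.
- by rewrite !size_map !size_iota.
- by rewrite !map_mkseq; split; apply: map_mkseq_sorted; auto.
- have bk : (b < k)%N by apply: leq_trans bl; rewrite -[ltnLHS]addn0 ltn_add2l.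
  move=> s sl; have bsk : (b + s < k)%N by apply: leq_trans bl; rewrite ltn_add2l.
  rewrite !map_mkseq !nth_mkseq //=; apply: tS.
  by rewrite ltn_double skip_end // ltn_double a2T.
have := place_approx v1T v2T; rewrite !size_mkseq => /(_ erefl erefl) h1.
rewrite -[X in `|X|](subrK (\sum_(i < T) place D v1 i - \sum_(i < T) place D v2 i)).
apply: le_trans (ler_normD _ _) _; apply: lerD => //.
rewrite -sumrB.
have := @block_upper _ _ _ _ _ B N T (fun i => place D v1 i - place D v2 i)
  (4 * L) Nh => upper.
apply: le_trans (upper _ _ _) _.
- by rewrite mulr_gt0.
- by move=> i _; exact: place_blockB.
- have -> : 4 * L = 2 * (2 * L) by ring.
  have L20 : 0 <= 2 * L by exact: mulr_ge0 (ltW L0).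
  rewrite powRM // powRM ?(ltW L0) //.
  apply: (@le_trans _ _ (2 `^ r * \sum_(i < T)
      (`|place D v1 i| `^ r + `|place D v2 i| `^ r))).
    rewrite mulr_sumr; apply: ler_sum => i _.
    apply: le_trans (powRD_le (ltW r0) (normr_ge0 _) (normr_ge0 _)).
    by apply: le_powR; rewrite ?(ltW r0) // ler_normB.
  rewrite ler_pM2l ?powR_gt0 // big_split /=.
  apply: (@le_trans _ _ (2 * L `^ r)); last first.
    by rewrite ler_pM2r ?powR_gt0 // ler_powR_base // ler1n.
  by rewrite mulr_natl mulr2n; apply: lerD; apply: even_place_lower.
rewrite ler_pM2l // lerD2l.
apply: le_trans (place_mass (k := k) (sigma := fun j => sigma j.+1) (e := e)
  _ _ _ _ _ _) _.
- by rewrite size_mkseq.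
- by rewrite size_mkseq.
- by move=> i; exact: mem_subseq_iota.
- by move=> i; exact: mem_subseq_iota.
- by move=> j jk; apply: D_mass_take; rewrite ?size_mkseq.
- by move=> j jk; apply: D_mass_take; rewrite ?size_mkseq.
rewrite ek lerD2l.
rewrite (eq_bigr (fun j : 'I_k =>
    if (b <= j < b + l)%N then `|sigma j.+1| *+ 2 else 0)); last first.
  move=> j _; rewrite !nth_mkseq //= (inj_eq double_inj).
  have [E|/skip_neq->//] := eqVneq.
  case: ifP => // /andP[bj jbl]; move: E; rewrite /a1 /a2 /skip jbl ltnNge bj /=.
  by move=> /eqP; rewrite -[X in X == _]addn0 eqn_add2l => /eqP l0'; rewrite -l0' in l0.
rewrite -big_mkcond /= -(big_mkord (fun j => b <= j < b + l)%N
  (fun j => `|sigma j.+1| *+ 2)).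
rewrite sumrMnl ler_wMn2r //.
suff -> : \sum_(0 <= j < k | (b <= j < b + l)%N) `|sigma j.+1| =
    \sum_(b <= j < b + l) `|sigma j.+1| by [].
by rewrite [RHS](big_nat_widenl _ 0) // [RHS](big_nat_widen _ _ k).
Qed.

End spread.

(** Interlacing forces the [r]-th powers of the block masses to have a bounded
    sum.  A long enough tuple therefore has [l] consecutive ranks whose masses
    have a bounded sum, with a bound independent of [l], and there [spread_pair]
    applies. *)
Lemma block_concentration (R : realType) (X : normedModType R)
    (U : set_system nat) (UU : UltraFilter U) (r A C : R) :
  \oo `<=` U -> block_structure U X r A -> 1 <= C ->
  exists K, forall l, (0 < l)%N -> exists k, forall f : seq nat -> X,
    (forall u v, size u = k.+1 -> sorted ltn u -> sorted ltn v ->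
      interlaced u v -> `|f u - f v| <= C) ->
    exists u v b, [/\ size u = k.+1 /\ size v = k.+1,
      sorted ltn u /\ sorted ltn v, (b + l <= k.+1)%N,
      forall s, (s < l)%N -> (nth 0 u (b + s) < nth 0 v b)%N &
      `|f u - f v| <= K].
Proof.
move=> Uoo B C1.
have A0 : 0 < A := lt_le_trans ltr01 (bconst_ge1 B).
have r0 : 0 < r := lt_le_trans ltr01 (bexp_ge1 B).
have C0 : 0 < C := lt_le_trans ltr01 C1.
pose L := A * (2 * C); pose M := 4 * (A * L).
have M0 : 0 < M by rewrite !mulr_gt0.
exists (1 + A * (4 * L + (1 + M *+ 2))) => l l0.
pose q := (Num.truncn (l%:R `^ r : R)).+1.
have lq : l%:R `^ r < q%:R by exact: truncnS_gt.
pose k := (q * l)%N.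
have k0 : (0 < k)%N by rewrite muln_gt0.
exists k.-1; rewrite prednK // => f f_lip.
pose e : R := (2 * k%:R)^-1.
have k0' : 0 < k%:R :> R by rewrite ltr0n.
have e0 : 0 < e by rewrite invr_gt0 mulr_gt0.
have ek : (e *+ 2) *+ k = 1.
  rewrite -[_ *+ k]mulr_natr -[e *+ 2]mulr_natr /e; field.
  by rewrite gt_eqF.
have [t [N [x0 [sigma [D [Nh tS DP Dmass fD]]]]]] :=
  block_decomposition Uoo B f_lip (k + l).*2 e0.
have [h hq hM] := light_block (sigma := fun j => sigma j.+1) r0 M0 l0 lq
  (sigma_lower C1 f_lip e0 ek Nh tS DP Dmass fD).
have bl : (h * l + l <= k)%N by rewrite -mulSnr leq_mul2r hq orbT.
rewrite mulSnr in hM.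
have [u [v [uvk suv uv fuv]]] :=
  spread_pair C1 f_lip e0 ek Nh tS DP Dmass fD l0 bl hM.
by exists u, v, (h * l)%N.
Qed.

(** * Interlaced graphs *)

Section kalton_walks.
Context {R : realType} {k : nat}.
Implicit Types x y : kalton R k.

(** One step of the graph moves an entry at most to the next one; hence a walk
    of length [s] cannot move the entry of rank [i] past that of rank [i + s]. *)
Lemma kalton_adj_nth x y i : kalton_adj x y -> (i.+1 < k)%N ->
  (nth 0 (val x) i.+1 >= nth 0 (val y) i)%N.
Proof.
move=> /andP[_ /orP[]] /kalton_leP[h1 h2] ik; last exact: h2.
apply: leq_trans (h1 i (ltnW ik)) _; apply: ltnW.
by apply: (sorted_ltn_nth ltn_trans 0%N (valP x)); rewrite ?inE ?size_tuple ?(ltnW ik).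
Qed.

Lemma kalton_walk_nth x y s i : is_walk kalton_adj x y s -> (i + size s < k)%N ->
  (nth 0 (val y) i <= nth 0 (val x) (i + size s))%N.
Proof.
elim: s x => [|z s IH] x [/= ps ls]; first by rewrite addn0 ls.
move: ps => /andP[xz ps]; rewrite addnS => ik.
apply: leq_trans (IH z _ (ltnW ik)) _; first by [].
exact: kalton_adj_nth.
Qed.

Lemma kalton_dist_ge x y b l : (b + l <= k)%N ->
  (forall s, (s < l)%N -> (nth 0 (val x) (b + s) < nth 0 (val y) b)%N) ->
  l%:R <= mdist x y.
Proof.
move=> bl xy; have [s w dE] := graph_dist_attained (R := R) (@kalton_connected R k) x y.
rewrite [mdist x y]dE ler_nat leqNgt; apply/negP => sl.
have bs : (b + size s < k)%N by apply: leq_trans bl; rewrite ltn_add2l.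
by have := kalton_walk_nth w bs; rewrite leqNgt xy.
Qed.

Lemma kalton_of_seq (u : seq nat) : size u = k -> sorted ltn u ->
  exists x, val (val x) = u.
Proof.
move=> /eqP uk su; have su' : sorted ltn (Tuple uk) by [].
by exists (exist _ (Tuple uk) su').
Qed.

Lemma interlaced_dist_le1 x y : interlaced (val (val x)) (val (val y)) ->
  mdist x y <= 1.
Proof.
move=> [_ xy]; have [->|ne] := eqVneq x y; first by rewrite mdistxx ler01.
apply: (@graph_dist_le R _ kalton_adj x y [:: y]).
rewrite /is_walk /= andbT; split=> //; rewrite /kalton_adj ne /=.
apply/orP; right; apply/kalton_leP; split=> i ik.
  by have [] := xy i; rewrite ?size_tuple.
by have [|_ ] := xy i; rewrite ?size_tuple ?(ltnW ik) //; apply.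
Qed.

End kalton_walks.

(** An equi-coarse embedding would send the pairs of tuples at distance at least
    [l] provided by [block_concentration] to points at bounded distance,
    although [rho l] tends to infinity. *)
Lemma not_equi_coarsely_embeds (R : realType) (U : set_system nat)
    (X : normedModType R) (r A : R) (N : metricType R) (iota : N -> X) :
  UltraFilter U -> \oo `<=` U -> block_structure U X r A ->
  (forall x y, mdist x y = `|iota y - iota x|) ->
  ~ equi_coarsely_embeds (fun k : nat => kalton R k.+1) N.
Proof.
move=> UU Uoo B iotaE [rho [omega [f [_ rho_oo bounds]]]].
pose C := Num.max 1 (omega 1).
have C1 : 1 <= C by rewrite le_max lexx.
have [K HK] := block_concentration UU Uoo B C1.
have [M [_ HM]] : \forall t \near +oo, K < rho t.
  by move/cvgryPgt : rho_oo; exact.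
pose l := (Num.truncn `|M|).+1.
have Ml : M < l%:R by apply: le_lt_trans (truncnS_gt _); exact: ler_norm.
have [k Hk] := HK l isT.
pose x0 : kalton R k.+1 := exist _ (iota_tuple k.+1 0) (iota_ltn_sorted 0 k.+1).
pose F u := iota (f k (xget x0 [set x | val (val x) = u])).
have FE (x : kalton R k.+1) : F (val (val x)) = iota (f k x).
  rewrite /F; congr (iota (f k _)); apply/val_inj/val_inj.
  by apply: (xgetPex x0 (P := [set y | val (val y) = val (val x)])); exists x.
have FC u v : size u = k.+1 -> sorted ltn u -> sorted ltn v -> interlaced u v ->
    `|F u - F v| <= C.
  move=> uk su sv uv; have vk : size v = k.+1 by case: uv => <-.
  have [x xE] := kalton_of_seq (R := R) uk su.
  have [y yE] := kalton_of_seq (R := R) vk sv.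
  rewrite -xE -yE !FE -iotaE metric_sym le_max; apply/orP; right.
  have xy1 : mdist x y <= 1 by apply: interlaced_dist_le1; rewrite xE yE.
  rewrite -lee_fin; have [_] := bounds k 1 ler01; apply: le_trans.
  rewrite /expansion le_max; apply/orP; right.
  by apply: ereal_sup_ubound; exists (x, y).
have [u [v [b [[uk vk] [su sv] bl uv fuv]]]] := Hk F FC.
have [x xE] := kalton_of_seq (R := R) uk su.
have [y yE] := kalton_of_seq (R := R) vk sv.
have lxy : l%:R <= mdist x y.
  by apply: (kalton_dist_ge bl) => s sl; have := uv s sl; rewrite -xE -yE.
have := HM _ Ml; rewrite ltNge => /negP; apply.
apply: le_trans fuv; rewrite -xE -yE !FE -iotaE metric_sym -lee_fin.
have [h _] := bounds k l%:R (ler0n _ _); apply: le_trans h _.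
by apply: ereal_inf_lbound; exists (x, y).
Qed.

(** * The block structure of the James space *)

Section jumps.
Context {R : realType} (p : R).
Implicit Types (x y : nat -> R) (s : seq nat).

(** The sum under the root in [variation_along p x (a :: s)], by recursion. *)
Fixpoint jumps x a s : R :=
  if s is b :: s' then `|x b - x a| `^ p + jumps x b s' else 0.

Lemma jumps_ge0 x a s : 0 <= jumps x a s.
Proof. by elim: s a => //= b s IH a; rewrite addr_ge0 ?powR_ge0. Qed.

Lemma variation_along_cons x a s :
  variation_along p x (a :: s) = jumps x a s `^ p^-1.
Proof.
rewrite /variation_along; congr (_ `^ _) => /=.
elim: s a => [|b s IH] a; first by rewrite big_ord0.
by rewrite big_ord_recl /= -IH.
Qed.

Lemma jumps_comp x y (h : nat -> nat) c a s : (forall n, y n = x (h n) + c) ->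
  jumps y a s = jumps x (h a) (map h s).
Proof.
move=> yE; elim: s a => //= b s IH a; rewrite IH !yE.
by rewrite opprD addrACA subrr addr0.
Qed.

Lemma jumps_cat x a s t :
  jumps x a (s ++ t) = jumps x a s + jumps x (last a s) t.
Proof. by elim: s a => /= [|b s IH] a; rewrite ?add0r // IH addrA. Qed.

Lemma jumps_iota x (N : nat -> nat) k T :
  jumps x (N k) (map N (iota k.+1 T)) =
  \sum_(i < T) `|x (N (k + i).+1) - x (N (k + i)%N)| `^ p.
Proof.
elim: T k => [|T IH] k; first by rewrite big_ord0.
rewrite big_ord_recl /= addn0 IH; congr (_ + _).
by apply: eq_bigr => i _; rewrite /bump add1n addnS addSn.
Qed.

Hypothesis p0 : 0 < p.

(** Repetitions contribute no jump. *)
Lemma jumps_strict x a s : path leq a s ->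
  exists2 s', path ltn a s' & jumps x a s' = jumps x a s.
Proof.
elim: s a => [|b s IH] a /=; first by exists [::].
move=> /andP[ab /IH[s' ps' E]]; have [eab|nab] := eqVneq a b.
  exists s'; first by rewrite eab.
  by rewrite eab E subrr normr0 powR0 ?gt_eqF // add0r.
by exists (b :: s'); rewrite /= ?E // ps' andbT ltn_neqAle nab.
Qed.

Lemma pvariation_le x c : (forall a s, path ltn a s -> jumps x a s <= c) ->
  (pvariation p x <= (c `^ p^-1)%:E)%E.
Proof.
move=> xc; apply: ge_ereal_sup => _ [[|a s] ss <-]; rewrite lee_fin.
  by rewrite /variation_along big_ord0 powR0 ?powR_ge0 // invr_eq0 gt_eqF.
rewrite variation_along_cons; apply: le_powR; rewrite ?invr_ge0 ?(ltW p0) //.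
  exact: jumps_ge0.
exact: xc.
Qed.

Lemma in_james x c : (forall a s, path ltn a s -> jumps x a s <= c) ->
  x n @[n --> \oo] --> 0 -> x \in james_pred p.
Proof.
move=> xc x0; rewrite inE; split=> //.
by apply: le_lt_trans (pvariation_le xc) _; rewrite ltry.
Qed.

(** Infinitely many disjoint jumps larger than [e] would have unbounded sum. *)
Lemma jumps_cauchy x c : (forall a s, path ltn a s -> jumps x a s <= c) ->
  forall e, 0 < e -> exists N0, forall M N, (N0 <= M <= N)%N -> `|x N - x M| <= e.
Proof.
move=> xc e e0.
have [||N0 hN0] := @interval_weight_small R (fun M N => `|x N - x M| `^ p) c
    _ _ (e `^ p) (powR_gt0 _ e0).
- by move=> *; exact: powR_ge0.
- move=> N T Nh; have := jumps_iota x N 0 T; rewrite /= => <-.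
  have [|s ps <-] := @jumps_strict x (N 0%N) (map N (iota 1 T)); last exact: xc.
  rewrite path_map; apply: (sub_path (e := leq)); first by move=> i j; exact: Nh.
  by apply: sub_path (iota_sorted 0 T.+1) => i j.
by exists N0 => M N MN; apply: (powR_le_inv p0 (ltW e0)); exact: hN0.
Qed.

End jumps.

Lemma path_minn N a s : path ltn a s ->
  path leq (minn a N) (map (minn^~ N) s).
Proof.
apply: (homo_path (f := minn^~ N)) => i j /= ij.
by rewrite leq_min geq_minr geq_min (ltnW ij).
Qed.

Lemma path_maxn N a s : path ltn a s ->
  path leq (maxn a N) (map (maxn^~ N) s).
Proof.
apply: (homo_path (f := maxn^~ N)) => i j /= ij.
by rewrite geq_max leq_maxr leq_max (ltnW ij).
Qed.

Section james_coordinates.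
Context {R : realType} {p : R} (p1 : 1 < p).
Implicit Types (x y : james p1) (N : nat).

Let p0 : 0 < p. Proof. exact: lt_trans ltr01 p1. Qed.

Lemma james_ext x y : x =1 y -> x = y.
Proof. by move=> xy; apply/val_inj/funext. Qed.

Lemma jamesD x y n : (x + y) n = x n + y n :> R. Proof. by []. Qed.
Lemma jamesN x n : (- x) n = - x n :> R. Proof. by []. Qed.
Lemma jamesZ (c : R) x n : (c *: x) n = c * x n :> R. Proof. by []. Qed.

Lemma james_sum T (z : 'I_T -> james p1) n :
  (\sum_i z i) n = \sum_i (z i n : R) :> R.
Proof. by apply: (big_morph (fun x : james p1 => x n : R)). Qed.

Lemma jumps_le x a s : path leq a s -> jumps p x a s <= `|x| `^ p.
Proof.
move=> /(jumps_strict p0 x)[s' ps' <-].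
have h : jumps p x a s' `^ p^-1 <= `|x|.
  rewrite -variation_along_cons -lee_fin [(`|x|)%:E]james_normE.
  exact: variation_along_le.
rewrite -[leLHS](powRr1 (jumps_ge0 _ _ _ _)) -(mulVf (lt0r_neq0 p0)) powRrM.
by apply: le_powR h; rewrite ?powR_ge0 ?(ltW p0).
Qed.

Lemma james_normX_le x c : (forall a s, path ltn a s -> jumps p x a s <= c) ->
  `|x| `^ p <= c.
Proof.
move=> xc; have c0 : 0 <= c := xc 0%N [::] isT.
rewrite -[leRHS](powRr1 c0) -(mulVf (lt0r_neq0 p0)) powRrM.
apply: le_powR; rewrite ?(ltW p0) // -lee_fin [(`|x|)%:E]james_normE.
exact: pvariation_le.
Qed.

Lemma james_jump_le x m n : `|x n - x m| <= `|x|.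
Proof.
wlog mn : m n / (m <= n)%N.
  by move=> H; have [|/ltnW] := leqP m n; [|rewrite distrC]; exact: H.
apply: (powR_le_inv p0) => //.
have := @jumps_le x m [:: n]; rewrite /= addr0 mn; exact.
Qed.

(** The jump from [n] to infinity is [- x n]. *)
Lemma james_coord_le x n : `|x n| <= `|x|.
Proof.
apply/ler_addgt0Pr => e e0.
have /cvgrPdist_le/(_ e e0)[M _ HM] := james_cvg0 x.
rewrite -(subrK (x M) (x n)); apply: le_trans (ler_normD _ _) _.
apply: lerD; first exact: james_jump_le.
by have := HM M (leqnn M); rewrite /= sub0r normrN.
Qed.

(** Up to [N] the jumps of [x] are kept, and there are none afterwards; the
    constant makes the sequence vanish at infinity. *)
Lemma james_proj_in N x : (fun n => x (minn n N) - x N : R^o) \in james_pred p.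
Proof.
apply: (@in_james _ _ p0 _ (`|x| `^ p)).
  move=> a s ps; rewrite (@jumps_comp _ p x _ (minn^~ N) (- x N)) //.
  exact/jumps_le/path_minn.
apply/cvgrPdist_le => e e0; exists N => // n /= Nn.
by rewrite (minn_idPr Nn) subrr subr0 normr0 ltW.
Qed.

Definition james_proj N x : james p1 := James p1 (james_proj_in N x).

Lemma james_projE N x n : james_proj N x n = x (minn n N) - x N :> R.
Proof. by []. Qed.

Lemma james_proj_linear N : linear (james_proj N).
Proof.
move=> c x y; apply: james_ext => n.
rewrite jamesD jamesZ !james_projE !jamesD !jamesZ mulrBr.
by rewrite opprD addrACA.
Qed.

HB.instance Definition _ N := GRing.isLinear.Build R (james p1) (james p1) _
  (james_proj N) (james_proj_linear N).

(** Paths for the two parts, cut off at [N], concatenate to a path for [x]. *)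
Lemma james_proj_split N x :
  `|james_proj N x| `^ p + `|x - james_proj N x| `^ p <= `|x| `^ p.
Proof.
rewrite -lerBrDr; apply: james_normX_le => a s pas.
rewrite lerBrDr addrC -lerBrDr; apply: james_normX_le => b t pbt.
rewrite lerBrDr addrC.
rewrite (@jumps_comp _ p x _ (minn^~ N) (- x N)) //.
rewrite (@jumps_comp _ p x (x - james_proj N x) (maxn^~ N) 0); last first.
  move=> n; rewrite jamesD jamesN james_projE addr0 /maxn /minn.
  by case: ltnP => nN; rewrite ?subrr ?subr0 // opprB addrC subrK.
pose u := map (minn^~ N) s; pose w := map (maxn^~ N) t.
have := @jumps_le x (minn a N) (u ++ maxn b N :: w).
rewrite jumps_cat /= addrA => h; apply: le_trans (h _).
  by rewrite -addrA; apply: lerD => //; rewrite lerDr powR_ge0.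
rewrite cat_path /= path_minn // path_maxn // andbT /=.
apply: leq_trans (leq_maxr _ _); rewrite /u (last_map (minn^~ N)).
exact: geq_minr.
Qed.

Lemma james_proj_proj M N x :
  james_proj M (james_proj N x) = james_proj (minn M N) x.
Proof.
apply: james_ext => n; rewrite !james_projE minnA.
by rewrite opprB addrA subrK.
Qed.

Lemma james_proj_le N x : `|james_proj N x| <= `|x|.
Proof.
apply: (powR_le_inv p0 (normr_ge0 x)).
by apply: le_trans (james_proj_split N x); rewrite lerDl powR_ge0.
Qed.

Lemma james_lower (N : nat -> nat) T x : {homo N : i j / (i <= j)%N} ->
  \sum_(i < T) `|james_proj (N i.+1) x - james_proj (N i) x| `^ p <= `|x| `^ p.
Proof.
move=> Nh; apply: le_trans (_ : `|james_proj (N T) x| `^ p <= _); last first.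
  by apply: le_powR (james_proj_le _ _); rewrite ?(ltW p0).
elim: T => [|T IH]; first by rewrite big_ord0 powR_ge0.
rewrite big_ord_recr /=; apply: le_trans (james_proj_split (N T) _).
have NT : (N T <= N T.+1)%N by exact: Nh.
by rewrite james_proj_proj (minn_idPl NT) lerD2r.
Qed.

Lemma james_lsc x K : (forall N, `|james_proj N x| <= K) -> `|x| <= K.
Proof.
move=> xK; have K0 : 0 <= K := le_trans (normr_ge0 _) (xK 0%N).
apply: (powR_le_inv p0 K0); apply: james_normX_le => a s ps.
pose N := \max_(i <- a :: s) i.
have iN i : i \in a :: s -> minn i N = i.
  by move=> ias; apply/minn_idPl; exact: (@leq_bigmax_seq _ _ xpredT id).
apply: (@le_trans _ _ (`|james_proj N x| `^ p)); last first.
  by apply: le_powR; rewrite ?(ltW p0).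
have pl : path leq a s by apply: sub_path ps => i j /ltnW.
apply: le_trans (@jumps_le (james_proj N x) a s pl).
rewrite (@jumps_comp _ p x (james_proj N x) (minn^~ N) (- x N)) //.
rewrite iN ?mem_head // (_ : map _ s = s) // -[RHS]map_id.
by apply/eq_in_map => i is_; rewrite iN // in_cons is_ orbT.
Qed.

End james_coordinates.

(** * Disjoint sums and limits in the James space *)

(** Each term is at most the [p]-norm of the family, and two terms survive. *)
Lemma two_spikes (R : realType) (p : R) (d : nat -> R) T o1 o2 : 0 < p ->
  (forall i, i != o1 -> i != o2 -> d i = 0) ->
  `|\sum_(i < T) d i| `^ p <= 2 `^ p * \sum_(i < T) `|d i| `^ p.
Proof.
move=> p0 d0; pose S := \sum_(i < T) `|d i| `^ p.
have S0 : 0 <= S by apply: sumr_ge0 => i _; exact: powR_ge0.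
pose m := S `^ p^-1; have m0 : 0 <= m by exact: powR_ge0.
have mS : m `^ p = S by rewrite /m -powRrM mulVf ?lt0r_neq0 // powRr1.
have dm (i : 'I_T) : `|d i| <= m.
  apply: (powR_le_inv p0 m0); rewrite mS /S (bigD1 i) //= lerDl.
  by apply: sumr_ge0 => j _; exact: powR_ge0.
have spike o : \sum_(i < T) (if i == o :> nat then m else 0) <= m.
  have [oT|To] := ltnP o T.
    by under eq_bigr do rewrite eq_sym; rewrite sum_pick.
  rewrite big1 // => i _; rewrite ltn_eqF //; exact: leq_trans To.
rewrite -/S -mS -powRM //; apply: le_powR => //; first exact: ltW.
apply: le_trans (ler_norm_sum _ _ _) _; rewrite mulr_natl mulr2n.
apply: le_trans (lerD (spike o1) (spike o2)); rewrite -big_split /=.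
apply: ler_sum => i _.
have [_|n1] := eqVneq (i : nat) o1.
  by apply: le_trans (dm i) _; rewrite lerDl; case: ifP.
have [_|n2] := eqVneq (i : nat) o2; first by rewrite add0r.
by rewrite d0 // normr0 addr0.
Qed.

Section james_blocks.
Context {R : realType} {p : R} (p1 : 1 < p).
Implicit Types (x y : james p1) (N : nat).

Let p0 : 0 < p. Proof. exact: lt_trans ltr01 p1. Qed.

Let initial N n : R := (n < N)%:R.

Lemma jumps_initial N a s : path ltn a s ->
  jumps p (initial N) a s <= (a < N)%:R.
Proof.
elim: s a => [|b s IH] a /=; first by rewrite ler0n.
move=> /andP[ab /IH h]; apply: le_trans (lerD (lexx _) h) _.
rewrite /initial; have [bN|Nb] := ltnP b N.
  by rewrite (ltn_trans ab bN) subrr normr0 powR0 ?gt_eqF // add0r.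
rewrite addr0 sub0r normrN; case: (a < N)%N; first by rewrite normr1 powR1.
by rewrite normr0 powR0 ?gt_eqF.
Qed.

Lemma initial_in N : (initial N : nat -> R^o) \in james_pred p.
Proof.
apply: (@in_james _ _ p0 _ 1) => [a s pas|].
  by apply: le_trans (jumps_initial N pas) _; rewrite lern1 leq_b1.
apply/cvgrPdist_le => e e0; exists N => // n /= Nn.
by rewrite /initial ltnNge Nn subrr normr0 ltW.
Qed.

Definition ones N : james p1 := James p1 (initial_in N).

Lemma onesE N n : ones N n = (n < N)%:R :> R. Proof. by []. Qed.

Lemma ones_le1 N : `|ones N| <= 1.
Proof.
apply: (powR_le_inv p0 ler01); rewrite powR1; apply: james_normX_le => a s pas.
by apply: le_trans (jumps_initial N pas) _; rewrite lern1 leq_b1.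
Qed.

(** At every index at most one summand is non-zero, so a jump of the sum
    involves at most two summands. *)
Lemma james_disjoint (N : nat -> nat) T (z : nat -> james p1) :
  {homo N : i j / (i <= j)%N} ->
  (forall i n, ~~ (N i <= n < N i.+1)%N -> z i n = 0 :> R) ->
  `|\sum_(i < T) z i| `^ p <= 2 `^ p * \sum_(i < T) `|z i| `^ p.
Proof.
move=> Nh z0.
have spike n : exists o, forall i, i != o -> z i n = 0 :> R.
  have [[i0 hi0]|no] := pselect (exists o, (N o <= n < N o.+1)%N); last first.
    by exists 0%N => i _; apply: z0; apply/negP => h; apply: no; exists i.
  exists i0 => i io; apply: z0; apply/negP => ino; case/eqP: io.
  have lt_absurd a b : (N a <= n < N a.+1)%N -> (N b <= n < N b.+1)%N -> ~ (a < b)%N.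
    move=> /andP[_ na] /andP[bn _] /Nh; rewrite leqNgt => /negP; apply.
    exact: leq_ltn_trans na.
  by case: (ltngtP i i0) => // h; case: (lt_absurd _ _ _ _ h).
apply: james_normX_le => a s pas.
have ps : path leq a s by apply: sub_path pas => i j /ltnW.
apply: (@le_trans _ _ (2 `^ p * \sum_(i < T) jumps p (z i) a s)); last first.
  by rewrite ler_pM2l ?powR_gt0 //; apply: ler_sum => i _; exact: jumps_le.
elim: s a {ps pas} => [|b s IH] a /=; first by rewrite big1 ?mulr0.
rewrite big_split /= mulrDr; apply: lerD; last exact: IH.
rewrite !james_sum -sumrB.
have [i1 h1] := spike a; have [i2 h2] := spike b.
apply: (@two_spikes R p (fun i => (z i b : R) - z i a) T i1 i2) => //.
by move=> i /h1-> /h2->; rewrite subrr.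
Qed.

(** A block is constant up to [N i]; subtracting its value there, which is its
    mass, from the initial part makes the blocks disjointly supported. *)
Lemma james_upper (N : nat -> nat) T (y : nat -> james p1) K :
  {homo N : i j / (i <= j)%N} -> 0 < K ->
  (forall i, (i < T)%N ->
    james_proj (N i.+1) (y i) - james_proj (N i) (y i) = y i) ->
  \sum_(i < T) `|y i| `^ p <= K `^ p ->
  `|\sum_(i < T) y i| <= 4 * (K + \sum_(i < T) `|y i 0%N|).
Proof.
move=> Nh K0 yP yK.
pose z i := if (i < T)%N then y i - (y i 0%N : R) *: ones (N i) else 0.
have zE (i : 'I_T) : z i = y i - (y i 0%N : R) *: ones (N i).
  by rewrite /z ltn_ord.
have z0 i n : ~~ (N i <= n < N i.+1)%N -> z i n = 0 :> R.
  rewrite /z; case: (ltnP i T) => // iT; rewrite jamesD jamesN jamesZ onesE.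
  rewrite negb_and -ltnNge -leqNgt => h.
  have Ni : (N i <= N i.+1)%N by exact: Nh.
  rewrite -(yP i iT) !jamesD !jamesN !james_projE !min0n.
  case/orP: h => h.
    rewrite h mulr1 (minn_idPl (ltnW h)) (minn_idPl (ltnW (leq_trans h Ni))).
    lra.
  rewrite ltnNge (leq_trans Ni h) /= mulr0 subr0 (minn_idPr h).
  by rewrite (minn_idPr (leq_trans Ni h)) !subrr.
have zK : `|\sum_(i < T) z i| <= 4 * K.
  apply: (powR_le_inv p0); first by rewrite mulr_ge0 ?ltW.
  apply: le_trans (james_disjoint T Nh z0) _.
  have -> : 4 * K = 2 * (2 * K) by ring.
  have K20 : 0 <= 2 * K by rewrite mulr_ge0 ?(ltW K0).
  rewrite powRM // ler_pM2l ?powR_gt0 // powRM ?(ltW K0) //.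
  apply: le_trans (_ : 2 `^ p * \sum_(i < T) `|y i| `^ p <= _); last first.
    by rewrite ler_pM2l ?powR_gt0.
  rewrite mulr_sumr; apply: ler_sum => i _; rewrite -powRM //.
  apply: le_powR; rewrite ?(ltW p0) // zE.
  apply: le_trans (ler_normB _ _) _; rewrite mulr_natl mulr2n lerD2l normrZ.
  rewrite -[leRHS]mulr1; apply: ler_pM => //; [exact: james_coord_le|].
  exact: ones_le1.
have -> : \sum_(i < T) y i =
    \sum_(i < T) z i + \sum_(i < T) (y i 0%N : R) *: ones (N i).
  by rewrite -big_split /=; apply: eq_bigr => i _; rewrite zE subrK.
apply: le_trans (ler_normD _ _) _; rewrite mulrDr; apply: lerD => //.
apply: le_trans (ler_norm_sum _ _ _) _; rewrite mulr_sumr; apply: ler_sum => i _.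
rewrite normrZ mulrC; apply: ler_wpM2r => //.
by apply: le_trans (ones_le1 _) _; rewrite ler1n.
Qed.

Lemma james_proj_coord_le N x :
  `|james_proj N x| <= \sum_(i < N) `|x i.+1 - x i|.
Proof.
elim: N => [|N IH].
  rewrite big_ord0 normr_le0; apply/eqP/james_ext => n.
  by rewrite james_projE minn0 subrr.
have -> : james_proj N.+1 x =
    james_proj N x + (x N - x N.+1 : R) *: ones N.+1.
  apply: james_ext => n; rewrite jamesD jamesZ !james_projE onesE.
  have [nN|Nn] := ltnP n N.+1.
    by rewrite (minn_idPl (nN : (n <= N)%N)) mulr1 addrA subrK.
  by rewrite (minn_idPr (ltnW Nn)) mulr0 !subrr addr0.
rewrite big_ord_recr /=; apply: le_trans (ler_normD _ _) _; apply: lerD => //.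
rewrite normrZ distrC -[leRHS]mulr1; apply: ler_pM => //; exact: ones_le1.
Qed.

Context (U : set_system nat) {UU : UltraFilter U}.

(** The coordinatewise limit [v] has bounded variation but need not vanish at
    infinity; since projections only see differences of coordinates, [v] may be
    replaced by [v - c], where [c] is its limit. *)
Lemma james_compact (phi : nat -> james p1) K :
  \oo `<=` U ->
  (\forall n \near U, `|phi n| <= K) ->
  exists x, forall N e, 0 < e ->
    \forall n \near U, `|james_proj N (phi n - x)| <= e.
Proof.
move=> Uoo phiK; pose v i : R := ulim U (fun n => phi n i).
have phiKi i : \forall n \near U, `|phi n i : R| <= K.
  by apply: filterS phiK => n; apply: le_trans; exact: james_coord_le.
have vK i : `|v i| <= K by exact: ulim_le.
have vE i e : 0 < e -> \forall n \near U, `|phi n i - v i : R| <= e.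
  by move=> e0; exact: (ulim_near (phiKi i)).
have vjumps a s : path ltn a s -> jumps p v a s <= 2 `^ p * K `^ p.
  move=> pas.
  (* A nonzero jump of the limit is eventually approximated up to half its
     size. *)
  have jump_near i j : \forall n \near U,
      `|v j - v i| `^ p <= 2 `^ p * `|phi n j - phi n i| `^ p.
    have [E|ne] := eqVneq (v j) (v i).
      by near=> n; rewrite E subrr normr0 powR0 ?gt_eqF // mulr_ge0 ?powR_ge0.
    have d0 : 0 < `|v j - v i| / 4 by rewrite divr_gt0 // normr_gt0 subr_eq0.
    near=> n; rewrite -powRM //; apply: le_powR; rewrite ?(ltW p0) //.
    have hi : `|phi n i - v i : R| <= `|v j - v i| / 4 by near: n; exact: vE.
    have hj : `|phi n j - v j : R| <= `|v j - v i| / 4 by near: n; exact: vE.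
    have : `|v j - v i| <= `|phi n j - phi n i : R| + `|phi n i - v i : R| +
        `|phi n j - v j : R|.
      have -> : v j - v i = (phi n j - phi n i : R) + (phi n i - v i : R) -
        (phi n j - v j : R) by ring.
      apply: le_trans (ler_normB _ _) _; rewrite lerD2r; exact: ler_normD.
    by lra.
  have near_jumps t b : \forall n \near U,
      jumps p v b t <= 2 `^ p * jumps p (phi n) b t.
    elim: t b => [|c t IH] b; first by near=> n; rewrite /= mulr0.
    near=> n; rewrite /= mulrDr; apply: lerD; first by near: n; exact: jump_near.
    by near: n; exact: IH.
  near U => n; apply: (@le_trans _ _ (2 `^ p * jumps p (phi n) a s)).
    by near: n; exact: near_jumps.
  rewrite ler_pM2l ?powR_gt0 //.
  apply: (@le_trans _ _ (`|phi n| `^ p)).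
    by apply: jumps_le; apply: sub_path pas => i j /ltnW.
  by apply: le_powR; rewrite ?(ltW p0) //; near: n.
pose c : R := ulim U v.
have vc : v n @[n --> \oo] --> c.
  apply/cvgrPdist_le => e e0; have e20 : 0 < e / 2 by rewrite divr_gt0.
  have [N0 hN0] := jumps_cauchy p0 vjumps e20.
  exists N0 => // n /= N0n.
  have cU : \forall m \near U, `|v m - c| <= e / 2.
    by apply: (ulim_near (K := K)) => //; near=> m; exact: vK.
  near U => m.
  have hm : `|v m - c| <= e / 2 by near: m.
  have nm : (n <= m)%N by near: m; apply: Uoo; exact: nbhs_infty_ge.
  have := hN0 n m; rewrite N0n nm => /(_ isT) hnm.
  have -> : c - v n = (v m - v n) - (v m - c) by ring.
  by rewrite [e]splitr; apply: le_trans (ler_normB _ _) _; exact: lerD.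
have xin : (fun n => v n - c : R^o) \in james_pred p.
  apply: (@in_james _ _ p0 _ (2 `^ p * K `^ p)) => [a s pas|].
    rewrite (@jumps_comp _ p v _ id (- c)) // map_id; exact: vjumps.
  by rewrite -(subrr c); apply: cvgB vc _; exact: cvg_cst.
exists (James p1 xin) => N e e0.
pose d := e / (2 * N.+1%:R).
have d0 : 0 < d by rewrite divr_gt0 // mulr_gt0.
near=> n; apply: le_trans (james_proj_coord_le N _) _.
have phid (i : 'I_N.+1) : `|phi n i - v i : R| <= d.
  by move: i; near: n; apply: filter_forall => i; exact: vE.
apply: (@le_trans _ _ (\sum_(i < N) d *+ 2)).
  apply: ler_sum => i _; rewrite !jamesD !jamesN /=.
  have -> : phi n i.+1 - (v i.+1 - c) - (phi n i - (v i - c)) =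
    (phi n i.+1 - v i.+1) - (phi n i - v i) :> R by ring.
  apply: le_trans (ler_normB _ _) _; rewrite mulr2n; apply: lerD.
    exact: (phid (lift ord0 i)).
  exact: (phid (widen_ord (leqnSn N) i)).
have dE : d *+ 2 * N.+1%:R = e.
  by rewrite -[d *+ 2]mulr_natl mulrAC mulrC /d divfK.
rewrite sumr_const card_ord -dE -[leLHS]mulr_natr ler_wpM2l ?ler_nat //.
by rewrite mulrn_wge0 // ltW.
Unshelve. all: by end_near. Qed.

(** Transparent, so that its projections are recognized as [james_proj]. *)
Definition james_blocks : \oo `<=` U -> block_structure U (james p1) p 4.
Proof.
move=> Uoo; apply: (@BlockStructure R U (james p1) p 4
  (fun N => james_proj N : {linear james p1 -> james p1}) (fun x => x 0%N)).
- by rewrite ler1n.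
- exact: ltW.
- exact: james_proj_proj.
- by move=> x; apply: james_ext => n; rewrite james_projE minn0 subrr.
- move=> N x; apply: le_trans (james_proj_le N x) _.
  by rewrite ler_peMl // ler1n.
- exact: james_lsc.
- by move=> phi K; exact: james_compact.
- by [].
- move=> x; apply: le_trans (james_coord_le x 0) _.
  by rewrite ler_peMl // ler1n.
- move=> N T x Nh; apply: le_trans (james_lower T x Nh) _.
  by apply: le_powR; rewrite ?(ltW p0) // ler_peMl // ler1n.
- exact: james_upper.
Defined.

End james_blocks.

(** * The block structure of the dual of the James space *)

Section young.
Context {R : realType} {p q : R}.
Hypotheses (p0 : 0 < p) (q0 : 0 < q) (pq : p^-1 + q^-1 = 1).

(** Hölder's inequality, from Young's inequality for [a_i / K] and [c_i]. *)
Lemma sum_young T (a c : 'I_T -> R) K : 0 < K ->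
  (forall i, 0 <= a i) -> (forall i, 0 <= c i) ->
  \sum_i a i `^ q <= K `^ q -> \sum_i c i `^ p <= 1 ->
  \sum_i a i * c i <= K.
Proof.
move=> K0 a0 c0 aK c1.
have KV0 : 0 <= K^-1 by rewrite invr_ge0 ltW.
have aK1 : \sum_i (a i / K) `^ q <= 1.
  rewrite (eq_bigr (fun i => a i `^ q * K^-1 `^ q)); last first.
    by move=> i _; rewrite powRM.
  rewrite -mulr_suml; apply: (@le_trans _ _ (K `^ q * K^-1 `^ q)).
    by rewrite ler_wpM2r ?powR_ge0.
  by rewrite -powRM ?(ltW K0) // divff ?gt_eqF // powR1.
have -> : \sum_i a i * c i = K * \sum_i (a i / K) * c i.
  rewrite mulr_sumr; apply: eq_bigr => i _.
  by rewrite mulrA mulrCA divff ?gt_eqF // mulr1.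
rewrite -[leRHS]mulr1 ler_pM2l //.
apply: (@le_trans _ _ (\sum_i ((a i / K) `^ q / q + c i `^ p / p))).
  apply: ler_sum => i _; apply: conjugate_powR => //.
    by rewrite mulr_ge0.
  by rewrite addrC.
rewrite big_split /= -!mulr_suml -pq addrC; apply: lerD.
  by rewrite ler_piMl // invr_ge0 ltW.
by rewrite ler_piMl // invr_ge0 ltW.
Qed.

(** Divide by [S ^ (1/p)], which leaves [S ^ (1/q)] on the left. *)
Lemma dual_exponent_bound (S M : R) : 0 <= S -> 0 <= M ->
  S <= M * S `^ p^-1 -> S <= M `^ q.
Proof.
move=> S0 M0 h; have [->|Sn0] := eqVneq S 0; first exact: powR_ge0.
have Sp : 0 < S by rewrite lt_neqAle eq_sym Sn0.
have Sq : S `^ q^-1 <= M.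
  rewrite -(ler_pM2r (powR_gt0 p^-1 Sp)) -powRD ?Sn0 ?implybT //.
  by rewrite addrC pq powRr1.
rewrite -[leLHS](powRr1 S0) -(mulVf (lt0r_neq0 q0)) powRrM.
by apply: le_powR; rewrite ?powR_ge0 ?(ltW q0).
Qed.

End young.

Section dual_elements.
Context {R : realType} {V : normedModType R}.

Lemma dual_in (h : V -> R^o) (K : R) : linear h ->
  (forall x, `|h x| <= K * `|x|) -> h \in dual_pred.
Proof.
move=> hl hK; rewrite inE; split=> //.
pose L : {linear V -> R^o} := HB.pack h (GRing.isLinear.Build R V R^o _ h hl).
apply/(linear_bounded_continuous L)/linear_boundedP.
exists K; split; first exact: num_real.
by move=> s Ks x; apply: le_trans (hK x) _; rewrite ler_wpM2r // ltW.
Qed.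

Implicit Types f g : dual V.

Lemma dual_ext f g : f =1 g -> f = g.
Proof. by move=> fg; apply/val_inj/funext. Qed.

Lemma dualD f g x : (f + g) x = f x + g x :> R. Proof. by []. Qed.
Lemma dualN f x : (- f) x = - f x :> R. Proof. by []. Qed.

Lemma dual_sum T (z : 'I_T -> dual V) x :
  (\sum_i z i) x = \sum_i (z i x : R) :> R.
Proof. by apply: (big_morph (fun f : dual V => f x : R)). Qed.

Lemma dual_le f x : `|f x : R| <= `|f| * `|x|.
Proof. exact: ler_dual_norm. Qed.

Lemma dual_le1 f x : `|x| <= 1 -> `|f x : R| <= `|f|.
Proof.
by move=> x1; apply: le_trans (dual_le f x) _; rewrite ler_piMr.
Qed.

Lemma dual_norm_bound f (M : R) :
  (forall x, `|x| <= 1 -> `|f x : R| <= M) -> `|f| <= M.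
Proof. exact: dual_norm_le. Qed.

Lemma dual_half_attained f : exists2 x, `|x| <= 1 & `|f| <= 2 * (f x : R).
Proof.
apply: contrapT => no.
have f2 : `|f| <= `|f| / 2.
  apply: dual_norm_bound => x x1; rewrite leNgt; apply/negP => h; apply: no.
  have [fx0|fx0] := leP 0 (f x : R).
    by exists x => //; move: h; rewrite ger0_norm //; lra.
  exists (- x); first by rewrite normrN.
  by rewrite linearN /=; move: h; rewrite ltr0_norm //; lra.
apply: no; exists 0; first by rewrite normr0 ler01.
by rewrite linear0 mulr0; lra.
Qed.

End dual_elements.

Section dual_blocks.
Context {R : realType} {p : R} (p1 : 1 < p).
Local Notation V := (james p1).
Implicit Types (x : V) (y : dual V) (N : nat).

Let p0 : 0 < p. Proof. exact: lt_trans ltr01 p1. Qed.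

(** Unlike [james_proj], this keeps the first [N] values, not jumps: it is the
    projection of the unit vector basis, whose adjoint acts on functionals. *)
Definition james_restr N x : V := james_proj N x + (x N : R) *: ones p1 N.

Lemma james_restrE N x n :
  james_restr N x n = if (n < N)%N then x n : R else 0 :> R.
Proof.
rewrite jamesD jamesZ james_projE onesE; case: (ltnP n N) => nN.
  by rewrite mulr1 subrK.
by rewrite mulr0 addr0 subrr.
Qed.

Lemma james_restr_linear N : linear (james_restr N).
Proof.
move=> c x z; apply: james_ext => n.
rewrite james_restrE [RHS]jamesD jamesZ !james_restrE jamesD jamesZ.
by case: ifP; rewrite ?mulr0 ?addr0.
Qed.

HB.instance Definition _ N := GRing.isLinear.Build R V V _
  (james_restr N) (james_restr_linear N).

Lemma james_restr_le N x : `|james_restr N x| <= 2 * `|x|.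
Proof.
apply: le_trans (ler_normD _ _) _; rewrite mulr_natl mulr2n.
apply: lerD; first exact: james_proj_le.
rewrite normrZ -[leRHS]mulr1; apply: ler_pM => //; first exact: james_coord_le.
exact: ones_le1.
Qed.

Lemma james_restr_restr M N x :
  james_restr M (james_restr N x) = james_restr (minn M N) x.
Proof.
apply: james_ext => n; rewrite !james_restrE leq_min.
by case: (n < M)%N; case: (n < N)%N.
Qed.

Lemma james_restr_ones M N : james_restr M (ones p1 N) = ones p1 (minn M N).
Proof.
apply: james_ext => n; rewrite james_restrE !onesE leq_min.
by case: (n < M)%N; case: (n < N)%N.
Qed.

Lemma james_restr_sum N x :
  james_restr N x = \sum_(i < N) (x i : R) *: (ones p1 i.+1 - ones p1 i).
Proof.
apply: james_ext => n; rewrite james_restrE james_sum.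
under eq_bigr => i _ do rewrite jamesZ jamesD jamesN !onesE ltnS.
case: (ltnP n N) => nN; last first.
  rewrite big1 // => i _; have iN : (i < n)%N by exact: leq_trans nN.
  by rewrite leqNgt iN ltnNge (ltnW iN) subrr mulr0.
rewrite (bigD1 (Ordinal nN)) //= leqnn ltnn subr0 mulr1 big1 ?addr0 // => i ne.
have [ni|ni|E] := ltngtP n i; rewrite ?subrr ?mulr0 //.
by case/eqP: ne; apply/val_inj.
Qed.

Lemma dual_proj_in N y : (fun x => y (james_restr N x)) \in dual_pred.
Proof.
apply: (@dual_in _ _ _ (`|y| * 2)) => [c x z|x].
  by rewrite !linearP.
apply: le_trans (dual_le _ _) _; rewrite -mulrA ler_wpM2l //.
exact: james_restr_le.
Qed.

Definition dual_proj N y : dual V := Dual (dual_proj_in N y).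

Lemma dual_projE N y x : dual_proj N y x = y (james_restr N x). Proof. by []. Qed.

Lemma dual_proj_linear N : linear (dual_proj N).
Proof. by move=> c y z; apply: dual_ext => x. Qed.

HB.instance Definition _ N := GRing.isLinear.Build R (dual V) (dual V) _
  (dual_proj N) (dual_proj_linear N).

Lemma dual_proj_proj M N y : dual_proj M (dual_proj N y) = dual_proj (minn M N) y.
Proof.
by apply: dual_ext => x; rewrite !dual_projE james_restr_restr minnC.
Qed.

Lemma dual_proj_le N y : `|dual_proj N y| <= 2 * `|y|.
Proof.
apply: dual_norm_bound => x x1; rewrite dual_projE.
apply: le_trans (dual_le _ _) _; rewrite mulrC ler_wpM2r //.
by apply: le_trans (james_restr_le _ _) _; rewrite ler_piMr.
Qed.

Context (U : set_system nat) {UU : UltraFilter U} (Uoo : \oo `<=` U).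

Lemma james_restr_tail x e : 0 < e -> exists N, `|x - james_restr N x| <= e.
Proof.
move=> e0; have e20 : 0 < e / 2 by rewrite divr_gt0.
have [N0 hN0] := block_tail (james_blocks p1 Uoo) x e20.
have /cvgrPdist_le/(_ _ e20)[N1 _ hN1] := james_cvg0 x.
exists (maxn N0 N1); rewrite /james_restr opprD addrA [e]splitr.
apply: le_trans (ler_normB _ _) _; apply: lerD.
  exact: (hN0 _ (leq_maxl N0 N1)).
rewrite normrZ -[leRHS]mulr1; apply: ler_pM => //; last exact: ones_le1.
by have := hN1 _ (leq_maxr N0 N1); rewrite /= sub0r normrN.
Qed.

(** The finitely supported vectors are dense. *)
Lemma dual_lsc y K : (forall N, `|dual_proj N y| <= K) -> `|y| <= K.
Proof.
move=> yK; apply: dual_norm_bound => x x1; apply/ler_addgt0Pr => e e0.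
have d0 : 0 < e / (`|y| + 1) by rewrite divr_gt0 // ltr_wpDl.
have [N hN] := james_restr_tail x d0.
rewrite -(subrK (james_restr N x) x) linearD addrC.
apply: le_trans (ler_normD _ _) _; apply: lerD.
  by apply: le_trans (yK N); exact: (dual_le1 (dual_proj N y) x1).
apply: le_trans (dual_le _ _) _.
apply: (@le_trans _ _ ((`|y| + 1) * (e / (`|y| + 1)))).
  by apply: ler_pM => //; rewrite lerDl.
by rewrite mulrC divfK // gt_eqF // ltr_wpDl.
Qed.

(** The value of the functional at the constant sequence 1, which is not in the
    James space; the ultrafilter provides a limit at no cost. *)
Definition dual_mass y : R := ulim U (fun N => y (ones p1 N)).

Let ones_near y : \forall N \near U, `|y (ones p1 N) : R| <= `|y|.
Proof. by near=> N; apply: dual_le1; exact: ones_le1.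
Unshelve. all: by end_near. Qed.

Lemma dual_massB y z : dual_mass (y - z) = dual_mass y - dual_mass z.
Proof.
apply: (cvg_lim (@norm_hausdorff _ R^o)).
exact: cvgB (ultra_cvg (ones_near y)) (ultra_cvg (ones_near z)).
Qed.

Lemma dual_mass_le y : `|dual_mass y| <= `|y|.
Proof. exact: ulim_le. Qed.

Lemma dual_mass_block a b y : (a <= b)%N -> dual_proj b y - dual_proj a y = y ->
  dual_mass y = y (ones p1 b - ones p1 a).
Proof.
move=> ab yE; apply: (lim_near_cst (@norm_hausdorff _ R^o)).
have : \forall N \near U, (b <= N)%N by apply: Uoo; exact: nbhs_infty_ge.
apply: filterS => N bN; rewrite -{1}yE dualD dualN !dual_projE.
rewrite !james_restr_ones (minn_idPl bN) (minn_idPl (leq_trans ab bN)).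
by rewrite linearB.
Qed.

Lemma dual_compact (phi : nat -> dual V) K :
  (\forall n \near U, `|phi n| <= K) ->
  exists y, forall N e, 0 < e ->
    \forall n \near U, `|dual_proj N (phi n - y)| <= e.
Proof.
move=> phiK; pose h x : R^o := ulim U (fun n => phi n x).
have phix x : \forall n \near U, `|phi n x : R| <= K * `|x|.
  apply: filterS phiK => n nK; apply: le_trans (dual_le _ _) _.
  exact: ler_wpM2r.
have hlin : linear h.
  move=> c x z; apply: (cvg_lim (@norm_hausdorff _ R^o)).
  under eq_fun do rewrite linearP.
  apply: cvgD (ultra_cvg (phix z)); apply: cvgZl_tmp; exact: ultra_cvg (phix x).
have hK x : `|h x| <= K * `|x| by exact: ulim_le.
pose y : dual V := Dual (dual_in hlin hK); exists y => N e e0.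
pose u i := ones p1 i.+1 - ones p1 i.
pose d := e / N.+1%:R.
have d0 : 0 < d by rewrite divr_gt0.
near=> n.
have zu (i : 'I_N) : `|(phi n - y) (u i) : R| <= d.
  by move: i; near: n; apply: filter_forall => i; exact: (ulim_near (phix _)).
apply: dual_norm_bound => x x1; rewrite dual_projE.
rewrite james_restr_sum linear_sum.
apply: le_trans (ler_norm_sum _ _ _) _.
apply: (@le_trans _ _ (\sum_(i < N) d)).
  apply: ler_sum => i _; rewrite linearZ normrM -[leRHS]mul1r.
  by apply: ler_pM => //; [exact: le_trans (james_coord_le x i) x1|exact: zu].
rewrite sumr_const card_ord -[leLHS]mulr_natr.
have dE : d * N.+1%:R = e by rewrite /d divfK.
by rewrite -dE ler_wpM2l ?ler_nat // ltW.
Unshelve. all: by end_near. Qed.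

Context (q : R) (pq : p^-1 + q^-1 = 1) (q1 : 1 < q).

Let q0 : 0 < q. Proof. exact: lt_trans ltr01 q1. Qed.

(** Norming vectors for the blocks of [y] can be supported in these blocks;
    their combination with weights [a_i ^ (q - 1)] is bounded by the upper
    estimate for disjointly supported sums in the James space. *)
Lemma dual_lower (N : nat -> nat) T y : {homo N : i j / (i <= j)%N} ->
  \sum_(i < T) `|dual_proj (N i.+1) y - dual_proj (N i) y| `^ q <=
  (16 * `|y|) `^ q.
Proof.
move=> Nh; pose a i := `|dual_proj (N i.+1) y - dual_proj (N i) y|.
have a0 i : 0 <= a i by exact: normr_ge0.
pose S := \sum_(i < T) a i `^ q.
have S0 : 0 <= S by apply: sumr_ge0 => i _; exact: powR_ge0.
have ex i : exists x, `|x| <= 1 /\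
    a i <= 2 * ((dual_proj (N i.+1) y - dual_proj (N i) y) x : R).
  have [x x1 hx] := dual_half_attained (dual_proj (N i.+1) y - dual_proj (N i) y).
  by exists x.
have [x hx] := choice ex.
pose b i := james_restr (N i.+1) (x i) - james_restr (N i) (x i).
have yb i : a i <= 2 * (y (b i) : R).
  by have [_] := hx i; rewrite dualD dualN !dual_projE -linearB.
have b4 i : `|b i| <= 4.
  have [x1 _] := hx i; have x2 : 2 * `|x i| <= 2 by rewrite ler_piMr.
  apply: le_trans (ler_normB _ _) _; have -> : 4 = 2 + 2 :> R by ring.
  by apply: lerD; apply: le_trans (james_restr_le _ _) x2.
pose z i := (a i `^ (q - 1) : R) *: b i.
have z0 i n : ~~ (N i <= n < N i.+1)%N -> z i n = 0 :> R.
  rewrite jamesZ jamesD jamesN !james_restrE negb_and -ltnNge -leqNgt => h.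
  have Ni : (N i <= N i.+1)%N by exact: Nh.
  case/orP: h => h; first by rewrite h (leq_trans h Ni) subrr mulr0.
  by rewrite !ltnNge h (leq_trans Ni h) subr0 mulr0.
pose w := \sum_(i < T) z i.
have aq i : a i * a i `^ (q - 1) = a i `^ q.
  have [->|ai] := eqVneq (a i) 0; first by rewrite mul0r powR0 // gt_eqF.
  rewrite -{1}[a i]powRr1 // -powRD ?ai ?implybT //.
  by rewrite addrC subrK.
have Syw : S <= 2 * (y w : R).
  rewrite /w linear_sum /= mulr_sumr; apply: ler_sum => i _.
  by rewrite linearZ /= -aq mulrCA [a i * _]mulrC ler_wpM2l ?powR_ge0.
(* The weights [a_i ^ (q - 1)] have [p]-th powers [a_i ^ q]. *)
have qp : (q - 1) * p = q.
  have pE : p^-1 = (q - 1) / q.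
    by rewrite mulrBl divff ?gt_eqF // mul1r -pq addrK.
  apply: (mulIf (_ : p^-1 != 0)); first by rewrite invr_eq0 gt_eqF.
  by rewrite mulfK ?gt_eqF // pE mulrCA divff ?gt_eqF // mulr1.
have wS : `|w| <= 8 * S `^ p^-1.
  apply: (powR_le_inv p0); first by rewrite mulr_ge0 // powR_ge0.
  apply: le_trans (james_disjoint T Nh z0) _.
  rewrite powRM ?powR_ge0 // -powRrM mulVf ?gt_eqF // powRr1 //.
  have -> : 8 = 2 * 4 :> R by ring.
  rewrite powRM // -mulrA ler_pM2l ?powR_gt0 // mulr_sumr.
  apply: ler_sum => i _; rewrite normrZ ger0_norm ?powR_ge0 //.
  rewrite powRM ?powR_ge0 // -powRrM qp mulrC ler_wpM2r ?powR_ge0 //.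
  by apply: le_powR; rewrite ?(ltW p0).
apply: (dual_exponent_bound q0 pq S0); first exact: mulr_ge0.
rewrite -/S; apply: le_trans Syw _.
have -> : 16 * `|y| * S `^ p^-1 = 2 * (`|y| * (8 * S `^ p^-1)) by ring.
rewrite ler_pM2l //; apply: le_trans (ler_norm _) _.
by apply: le_trans (dual_le _ _) _; rewrite ler_wpM2l.
Qed.

(** On each block [x] is split into [x' i], which vanishes off the block and is
    bounded by the variation of [x] there, and a constant, on which the
    functional acts through its mass. The first parts are handled by Hölder's
    inequality, as the variations of [x] on the blocks are [p]-summable. *)
Lemma dual_upper (N : nat -> nat) T (y : nat -> dual V) K :
  {homo N : i j / (i <= j)%N} -> 0 < K ->
  (forall i, (i < T)%N ->
    dual_proj (N i.+1) (y i) - dual_proj (N i) (y i) = y i) ->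
  \sum_(i < T) `|y i| `^ q <= K `^ q ->
  `|\sum_(i < T) y i| <= 16 * (K + \sum_(i < T) `|dual_mass (y i)|).
Proof.
move=> Nh K0 yP yK; apply: dual_norm_bound => x x1.
have Ni i : (N i <= N i.+1)%N by exact: Nh.
pose c i := james_proj (N i.+1) x - james_proj (N i) x.
pose x' i := c i - (x (N i) - x (N i.+1) : R) *: ones p1 (N i).
have xE i : james_restr (N i.+1) x - james_restr (N i) x =
    x' i + (x (N i.+1) : R) *: (ones p1 (N i.+1) - ones p1 (N i)).
  by apply: james_ext => n;
     rewrite /james_restr !(jamesD, jamesN, jamesZ, james_projE, onesE); ring.
have x'c i : `|x' i| <= 2 * `|c i|.
  have jump : `|x (N i) - x (N i.+1) : R| <= `|c i|.
    have := james_coord_le (c i) 0; rewrite jamesD jamesN !james_projE !min0n.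
    have -> // : x 0 - x (N i.+1) - (x 0 - x (N i)) = x (N i) - x (N i.+1) :> R.
    by ring.
  have hones : `|(x (N i) - x (N i.+1) : R) *: ones p1 (N i)| <= `|c i|.
    rewrite normrZ; apply: le_trans (ler_wpM2l (normr_ge0 _) (ones_le1 _ _)) _.
    by rewrite mulr1.
  apply: le_trans (ler_normB _ _) _.
  by apply: le_trans (lerD (lexx _) hones) _; rewrite [leRHS]mulr_natl mulr2n.
have yx (i : 'I_T) :
    y i x = (y i (x' i) : R) + x (N i.+1) * dual_mass (y i) :> R.
  rewrite (dual_mass_block (Ni i) (yP i (ltn_ord i))).
  rewrite -{1}(yP i (ltn_ord i)) dualD dualN !dual_projE -linearB xE.
  by rewrite linearD linearZ.
have yc : \sum_(i < T) `|y i| * `|c i| <= K.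
  apply: (sum_young p0 q0 pq) => //.
  apply: le_trans (james_lower T x Nh) _.
  have one_p : 1 `^ p = 1 :> R by rewrite powR1.
  by rewrite -[leRHS]one_p; apply: le_powR; rewrite ?(ltW p0).
rewrite dual_sum; apply: le_trans (ler_norm_sum _ _ _) _.
apply: (@le_trans _ _ (\sum_(i < T) (2 * (`|y i| * `|c i|) + `|dual_mass (y i)|))).
  apply: ler_sum => i _; rewrite yx; apply: le_trans (ler_normD _ _) _.
  apply: lerD.
    by apply: le_trans (dual_le _ _) _; rewrite mulrCA ler_wpM2l.
  rewrite normrM ler_piMl //; exact: le_trans (james_coord_le _ _) x1.
rewrite big_split /= -mulr_sumr.
have mass0 : 0 <= \sum_(i < T) `|dual_mass (y i)| by exact: sumr_ge0.
by move: yc mass0; lra.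
Qed.

Definition dual_blocks : block_structure U (dual V) q 16.
Proof.
apply: (@BlockStructure R U (dual V) q 16
  (fun N => dual_proj N : {linear dual V -> dual V}) dual_mass).
- by rewrite ler1n.
- exact: ltW.
- exact: dual_proj_proj.
- move=> y; apply: dual_ext => x; rewrite dual_projE.
  by rewrite james_restr_sum big_ord0 linear0.
- move=> N y; apply: le_trans (dual_proj_le N y) _.
  by rewrite ler_wpM2r // ler_nat.
- exact: dual_lsc.
- exact: dual_compact.
- exact: dual_massB.
- by move=> y; apply: le_trans (dual_mass_le y) _; rewrite ler_peMl // ler1n.
- by move=> N T y Nh; exact: dual_lower.
- exact: dual_upper.
Qed.

End dual_blocks.

Theorem corollary5p3 (R : realType) (p : R) (p1 : 1 < p) :
  ~ equi_coarsely_embeds (fun k : nat => kalton R k.+1) (james p1) /\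
  ~ equi_coarsely_embeds (fun k : nat => kalton R k.+1) (dual (james p1)).
Proof.
have [U UU Uoo] := exists_free_ultrafilter.
split.
  apply: (not_equi_coarsely_embeds (iota := fun x : james p1 => x) UU Uoo
    (james_blocks p1 Uoo)); by [].
have p0 : 0 < p := lt_trans ltr01 p1.
pose q := (1 - p^-1)^-1.
have pV1 : p^-1 < 1 by rewrite invf_lt1.
have pq : p^-1 + q^-1 = 1 by rewrite invrK addrC subrK.
have q1 : 1 < q.
  by rewrite invf_gt1 ?subr_gt0 // gtrBl invr_gt0.
by apply: (not_equi_coarsely_embeds (iota := fun x : dual (james p1) => x) UU Uoo
  (dual_blocks p1 Uoo pq q1)).
Qed.
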